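(* If a randomized online algorithm for the online minimum linear arrangement problem on $n$ nodes (with the revealed graphs being collections of lines, or with the revealed graphs being collections of cliques) is $c$-competitive, then $c\ge \frac{1}{16}\cdot\log_2 n$.
   Context: Let $V$ be a set of $n$ nodes. A permutation is a bijection $\pi:V\to\{1,\dots,n\}$. A MinLA of a graph $G=(V,E)$ is a permutation $\pi$ minimizing $\sum_{\{x,y\}\in E}|\pi(x)-\pi(y)|$ among all permutations. $d(\pi,\pi')$ is the Kendall tau distance: the minimum number of swaps of adjacent elements transforming $\pi$ into $\pi'$. An instance consists of an initial permutation $\pi_0$ and a sequence $G_0,\dots,G_k$ of graphs on $V$ where $G_0$ has no edges. In a clique instance, every $G_i$ is a disjoint union of cliques (isolated nodes are cliques of size one) and $G_{i+1}$ is obtained from $G_i$ by merging exactly two cliques into one. In a line instance, every $G_i$ is a disjoint union of paths (isolated nodes are paths with one node) and $G_{i+1}$ is obtained from $G_i$ by adding one edge between two distinct components. Feasible solution: permutations $\pi_1,\dots,\pi_k$ such that $\pi_i$ is a MinLA of $G_i$ for each $i$; its cost is $\sum_{i=0}^{k-1}d(\pi_i,\pi_{i+1})$. A (randomized) online algorithm must choose $\pi_i$ knowing only $\pi_0,G_0,\dots,G_i$ (and its own random bits). $\mathrm{Opt}(\sigma)$ is the minimum cost of a feasible solution of the instance $\sigma$. A randomized algorithm is $c$-competitive (against the oblivious adversary) if on every fixed instance $\sigma$ of the class considered its expected cost is at most $c\cdot\mathrm{Opt}(\sigma)$. The claim is asserted for each of the two classes of instances.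
   Formalization: The formal theorem assumes n ≥ 3; for n ≤ 2 every permutation is a MinLA of every graph, so never moving costs 0 and is c-competitive for every real c, and the stated bound fails (e.g. n = 2, c = 0). *)

(* Defs.v *)
(* Mathematical Components, with MathComp-Analysis for the randomness. *)
From mathcomp Require Import all_boot all_fingroup.
From mathcomp Require Import zify.

Set Implicit Arguments.
Unset Strict Implicit.
Unset Printing Implicit Defensive.

(* Positions are numbered 0 .. n-1 instead of 1 .. n, where n = #|V|; an
   injection between sets of the same finite cardinality is a bijection. *)
Definition arrangement (V : finType) : Type :=
  {p : {ffun V -> 'I_#|V|} | injectiveb p}.

Definition position (V : finType) (p : arrangement V) : V -> 'I_#|V| := val p.
Coercion position : arrangement >-> Funclass.

Definition adjacent_swap (V : finType) : rel (arrangement V) :=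
  fun p q => [exists x, exists y,
    (p y == (p x).+1 :> nat) && [forall z, q z == p (tperm x y z)]].

Lemma position_inj (V : finType) (p : arrangement V) : injective p.
Proof. exact/injectiveP/(valP p). Qed.

Lemma arrangementP (V : finType) (p q : arrangement V) : p =1 q -> p = q.
Proof. by move=> pq; apply/val_inj/ffunP. Qed.

Lemma relabel_proof (V : finType) (s : {perm V}) (p : arrangement V) :
  injectiveb [ffun x => p (s x)].
Proof.
by apply/injectiveP => x y; rewrite !ffunE => /position_inj /perm_inj.
Qed.

Definition relabel (V : finType) (s : {perm V}) (p : arrangement V) :
  arrangement V := Sub [ffun x => p (s x)] (relabel_proof s p).

Lemma relabelE (V : finType) (s : {perm V}) (p : arrangement V) x :
  relabel s p x = p (s x).
Proof. by rewrite /position /= ffunE. Qed.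

Lemma adjacent_swap_relabel (V : finType) (p : arrangement V) (x y : V) :
  p y = (p x).+1 :> nat -> adjacent_swap p (relabel (tperm x y) p).
Proof.
move=> pxy; apply/existsP; exists x; apply/existsP; exists y.
by rewrite pxy eqxx; apply/forallP => z; rewrite relabelE.
Qed.

Lemma position_surj (V : finType) (p : arrangement V) (i : 'I_#|V|) :
  exists x, p x = i.
Proof.
have [|q _ qK] := inj_card_bij (@position_inj V p); first by rewrite card_ord.
by exists (q i).
Qed.

Lemma connect_relabel_tperm (V : finType) (m : nat) (p : arrangement V)
    (x y : V) :
  p y = p x + m.+1 :> nat ->
  connect (@adjacent_swap V) p (relabel (tperm x y) p).
Proof.
elim: m => [|m IHm] in p x y *.
  by rewrite addn1 => /adjacent_swap_relabel /connect1.
move=> pxy.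
have lt_i : p x + m.+1 < #|V|.
  by apply: leq_ltn_trans (ltn_ord (p y)); rewrite pxy leq_add2l.
have [z pz] := position_surj p (Ordinal lt_i).
have pzE : p z = p x + m.+1 :> nat by rewrite pz.
have xy : x != y by apply/eqP => xy; move: pxy; rewrite xy; lia.
have xz : x != z by apply/eqP => xz; move: pzE; rewrite xz; lia.
have zy : z != y by apply/eqP => zy; move: pxy; rewrite -zy pzE; lia.
have yx : y != x by rewrite eq_sym.
have zx : z != x by rewrite eq_sym.
have yz : y != z by rewrite eq_sym.
set p1 := relabel (tperm z y) p.
have c1 : connect (@adjacent_swap V) p p1.
  by apply/connect1/adjacent_swap_relabel; rewrite pxy pzE addnS.
set p2 := relabel (tperm x y) p1.
have c2 : connect (@adjacent_swap V) p1 p2.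
  by apply: IHm; rewrite !relabelE tpermR tpermD.
have -> : relabel (tperm x y) p = relabel (tperm x z) p2.
  apply: arrangementP => t; rewrite !relabelE; congr (p _).
  case: (eqVneq t x) => [->|tx].
    by rewrite tpermL tpermL (@tpermD _ x y z) // tpermL.
  case: (eqVneq t y) => [->|ty].
    by rewrite tpermR (@tpermD _ x z y) // tpermR tpermD.
  case: (eqVneq t z) => [->|tz].
    by rewrite tpermR tpermL tpermR tpermD.
  by rewrite !tpermD // eq_sym.
apply: connect_trans c1 (connect_trans c2 _).
apply/connect1/adjacent_swap_relabel.
rewrite !relabelE (@tpermD _ x y z) // tpermL tpermL tpermR.
by rewrite pxy pzE addnS.
Qed.

Lemma relabelM (V : finType) (s t : {perm V}) (p : arrangement V) :
  relabel s (relabel t p) = relabel (s * t)%g p.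
Proof. by apply: arrangementP => x; rewrite !relabelE permM. Qed.

Lemma adjacent_swap_connected (V : finType) (p q : arrangement V) :
  connect (@adjacent_swap V) p q.
Proof.
have [|p' pK p'K] := inj_card_bij (@position_inj V p); first by rewrite card_ord.
have inj_f : injective (fun x => p' (q x)).
  by move=> x y /(can_inj p'K) /position_inj.
have -> : q = relabel (perm inj_f) p.
  by apply: arrangementP => x; rewrite relabelE permE p'K.
have step (x y : V) (r : arrangement V) :
    connect (@adjacent_swap V) r (relabel (tperm x y) r).
  wlog lexy : x y / r x <= r y.
    by case/orP: (leq_total (r x) (r y)) => ?; [|rewrite tpermC]; apply.
  case: (eqVneq x y) => [->|neq_xy].
    have -> // : relabel (tperm y y) r = r.
    by apply: arrangementP => z; rewrite relabelE tperm1 perm1.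
  have ltxy : r x < r y.
    rewrite ltn_neqAle lexy andbT; apply: contraNneq neq_xy.
    by move=> /val_inj /position_inj ->.
  apply: (@connect_relabel_tperm _ (r y - r x).-1).
  by rewrite prednK ?subn_gt0 // subnKC.
case: (prod_tpermP (perm inj_f)) => ts -> _.
elim: ts => [|u ts IHts].
  have -> // : relabel (\prod_(u <- [::]) tperm u.1 u.2)%g p = p.
  by apply: arrangementP => x; rewrite relabelE big_nil perm1.
by rewrite big_cons -relabelM; apply: connect_trans IHts (step _ _ _).
Qed.

Definition reachable_in (V : finType) (p q : arrangement V) (m : nat) : bool :=
  [exists t : m.-tuple (arrangement V),
     path (@adjacent_swap V) p t && (last p t == q)].

Lemma kendall_tau_proof (V : finType) (p q : arrangement V) :
  exists m, reachable_in p q m.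
Proof.
have /connectP[t path_t ->] := adjacent_swap_connected p q.
exists (size t); apply/existsP; exists (in_tuple t).
by rewrite path_t eqxx.
Qed.

Definition kendall_tau (V : finType) (p q : arrangement V) : nat :=
  ex_minn (kendall_tau_proof p q).

(* A simple graph is given by its edges {x, y}; both instance classes below
   only contain graphs all of whose edges are 2-element sets. *)
Definition graph (V : finType) : Type := {set {set V}}.

Definition adjacent (V : finType) (G : graph V) : rel V :=
  fun x y => [set x; y] \in G.

Definition component (V : finType) (G : graph V) (x : V) : {set V} :=
  [set y | connect (adjacent G) x y].

(* Each edge is counted once, as the ordered pair listing its ends from left
   to right; the truncated subtraction is then the absolute difference. *)
Definition la_cost (V : finType) (G : graph V) (p : arrangement V) : nat :=
  \sum_(xy : V * V | ([set xy.1; xy.2] \in G) && (p xy.1 < p xy.2))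
     (p xy.2 - p xy.1).

Definition minla (V : finType) (G : graph V) (p : arrangement V) : bool :=
  [forall q : arrangement V, la_cost G p <= la_cost G q].

Inductive instance_class := Cliques | Lines.

Definition clique_edges (V : finType) (B : {set V}) : graph V :=
  [set e : {set V} | (e \subset B) && (#|e| == 2)].

Definition disjoint_cliques (V : finType) (G : graph V) : Prop :=
  exists2 P : {set {set V}},
    partition P [set: V] & G = \bigcup_(B in P) clique_edges B.

Definition path_edges (V : finType) (s : seq V) : graph V :=
  [set [set xy.1; xy.2] | xy in zip s (behead s)].

Definition disjoint_lines (V : finType) (G : graph V) : Prop :=
  exists2 ss : seq (seq V),
    perm_eq (flatten ss) (enum V) & G = \bigcup_(s <- ss) path_edges s.

Definition merge_cliques (V : finType) (G H : graph V) : Prop :=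
  exists x y : V, ~~ connect (adjacent G) x y /\
    H = G :|: [set [set a; b] | a in component G x, b in component G y].

Definition add_line_edge (V : finType) (G H : graph V) : Prop :=
  exists x y : V, ~~ connect (adjacent G) x y /\ H = [set x; y] |: G.

Definition class_graph (cls : instance_class) (V : finType) (G : graph V) :
    Prop :=
  match cls with
  | Cliques => disjoint_cliques G
  | Lines => disjoint_lines G
  end.

Definition class_step (cls : instance_class) (V : finType) (G H : graph V) :
    Prop :=
  match cls with
  | Cliques => merge_cliques G H
  | Lines => add_line_edge G H
  end.

(* [revealed] lists G_1, ..., G_k; the edgeless graph G_0 is left implicit. *)
Record instance (V : finType) := Instance {
  initial : arrangement V;
  revealed : seq (graph V)
}.

Definition graph_at (V : finType) (sigma : instance V) (i : nat) : graph V :=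
  nth set0 (set0 :: revealed sigma) i.

Definition instance_of (cls : instance_class) (V : finType)
    (sigma : instance V) : Prop :=
  (forall i, i <= size (revealed sigma) -> class_graph cls (graph_at sigma i)) /\
  (forall i, i < size (revealed sigma) ->
     class_step cls (graph_at sigma i) (graph_at sigma i.+1)).

(* A solution lists pi_1, ..., pi_k. *)
Definition feasible (V : finType) (sigma : instance V)
    (sol : seq (arrangement V)) : bool :=
  all2 (@minla V) (revealed sigma) sol.

Definition cost (V : finType) (sigma : instance V)
    (sol : seq (arrangement V)) : nat :=
  sumn (pairmap (@kendall_tau V) (initial sigma) sol).

Definition feasible_cost (V : finType) (sigma : instance V) (m : nat) : bool :=
  [exists sol : (size (revealed sigma)).-tuple (arrangement V),
     feasible sigma sol && (cost sigma sol == m)].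

Lemma opt_proof (V : finType) (sigma : instance V) :
  exists m, feasible_cost sigma m.
Proof.
pose best G := [arg min_(p < initial sigma | true) la_cost G p].
pose sol := map_tuple best (in_tuple (revealed sigma)).
exists (cost sigma sol); apply/existsP; exists sol; rewrite eqxx andbT.
rewrite /feasible /sol /=; elim: (revealed sigma) => //= G Gs ->.
rewrite andbT; apply/forallP => q.
by rewrite /best; case: arg_minnP => // p _ ->.
Qed.

Definition opt (V : finType) (sigma : instance V) : nat :=
  ex_minn (opt_proof sigma).

(* Maps pi_0 and the revealed prefix G_1, ..., G_i to pi_i; earlier choices are
   functions of shorter prefixes, so they need not be passed. *)
Definition online_algorithm (V : finType) : Type :=
  arrangement V -> seq (graph V) -> arrangement V.

Definition run (V : finType) (A : online_algorithm V) (sigma : instance V) :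
    seq (arrangement V) :=
  mkseq (fun i => A (initial sigma) (take i.+1 (revealed sigma)))
        (size (revealed sigma)).

(* Imported only here: the classical sets and the finite sets used so far share
   names and notations. *)
From mathcomp Require Import all_order all_algebra.
From mathcomp Require Import all_classical all_reals all_analysis.

(* The random bits are a point w of the probability space T. *)
Definition randomized_online_algorithm (cls : instance_class) (V : finType)
    (d : measure_display) (T : measurableType d)
    (A : T -> online_algorithm V) : Prop :=
  forall sigma : instance V, instance_of cls sigma ->
    (forall p : arrangement V,
       measurable [set w | A w (initial sigma) (revealed sigma) = p]%classic) /\
    (forall w : T, feasible sigma (run (A w) sigma)).

Definition competitive (cls : instance_class) (V : finType) (R : realType)
    (d : measure_display) (T : measurableType d) (P : probability T R)
    (A : T -> online_algorithm V) (c : R) : Prop :=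
  forall sigma : instance V, instance_of cls sigma ->
    ('E_P[fun w => ((cost sigma (run (A w) sigma))%:R : R)%R]
       <= (c * (opt sigma)%:R)%:E)%E.

(* Main.v *)
(* The adversary knows the distribution of the algorithm's moves. With
   N = 2^k <= n, it merges N nodes in k rounds; at the beginning of a round all
   blocks (cliques or paths) have the same size L. In a MinLA every block is
   contiguous, so among any three blocks one lies between the other two. Hence,
   if m blocks are still unmerged in the round, averaging over all ordered pairs
   yields two blocks with at least (m - 2) / 3 others between them in
   expectation. Merging these two forces each block in between to cross one of
   them, that is, L^2 inversions per block. The rounds add up to an expected
   cost of at least N^2 (k - 2) / 12, whereas the optimum moves at once to an
   arrangement that lists the final block in order, which is a MinLA of all
   graphs of the instance and costs at most N^2. So c >= (k - 2) / 12, which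
   suffices for k >= 11; for smaller k, c >= 1 is enough. *)

Require Import Defs.
From mathcomp Require Import all_boot all_fingroup.
From mathcomp Require Import zify.

Set Implicit Arguments.
Unset Strict Implicit.
Unset Printing Implicit Defensive.

(** * Inversions and the Kendall tau distance *)

(** Positions as plain natural numbers, so that arithmetic on them is within reach of [lia]. *)
Definition pos (V : finType) (p : arrangement V) (x : V) : nat := p x.

Definition inversions (V : finType) (p q : arrangement V) : {set V * V} :=
  [set xy | (pos p xy.1 < pos p xy.2) && (pos q xy.2 < pos q xy.1)].

Lemma pos_eq (V : finType) (p : arrangement V) (x y : V) :
  (pos p x == pos p y) = (x == y).
Proof.
apply/eqP/eqP => [|-> //].
by move=> /val_inj; apply: position_inj.
Qed.

Lemma pos_ltn (V : finType) (p : arrangement V) (x : V) : pos p x < #|V|.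
Proof. exact: ltn_ord. Qed.

Lemma pos_relabel (V : finType) (s : {perm V}) (p : arrangement V) x :
  pos (relabel s p) x = pos p (s x).
Proof. by rewrite /pos relabelE. Qed.

Lemma pos_surj (V : finType) (p : arrangement V) (m : nat) :
  m < #|V| -> exists x, pos p x = m.
Proof.
move=> lt_m; have [x px] := position_surj p (Ordinal lt_m).
by exists x; rewrite /pos px.
Qed.

Lemma card_before (V : finType) (p : arrangement V) (m : nat) :
  m <= #|V| -> #|[set x | pos p x < m]| = m.
Proof.
move=> le_mn.
have [|q pK qK] := inj_card_bij (@position_inj V p); first by rewrite card_ord.
rewrite -(card_imset _ (@position_inj V p)).
rewrite -[RHS]card_ord -[RHS]sum1_card (big_ord_widen _ (fun=> 1) le_mn).
rewrite sum1_card; apply: eq_card => i.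
apply/imsetP/idP => [[x + ->]|Pi]; first by rewrite inE.
by exists (q i); rewrite ?inE /pos qK.
Qed.

Lemma pos_gap (V : finType) (p : arrangement V) (x y : V) :
  pos p x < pos p y ->
  pos p y - pos p x = (#|[set w | pos p x < pos p w < pos p y]|).+1.
Proof.
move=> ltxy.
have := card_before p (ltnW (pos_ltn p y)).
have := card_before p (pos_ltn p x).
set A := [set w | pos p w < (pos p x).+1].
set B := [set w | pos p w < pos p y] => cA cB.
have sAB : A \subset B by apply/subsetP => w; rewrite !inE; lia.
have := cardsID A B; rewrite (setIidPr sAB) cA cB.
have -> : B :\: A = [set w | pos p x < pos p w < pos p y].
  by apply/setP => w; rewrite !inE; lia.
lia.
Qed.

(** An adjacent swap reverses the relative order of the two swapped nodes only, so [(x, y)] is the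
    only inversion that can disappear. *)
Lemma inversions_swap (V : finType) (p p1 q : arrangement V) :
  adjacent_swap p p1 -> #|inversions p q| <= (#|inversions p1 q|).+1.
Proof.
case/existsP => x /existsP[y /andP[/eqP pxy0 /forallP p1E0]].
have {pxy0} pxy : pos p y = (pos p x).+1 := pxy0.
have {p1E0} p1E z : pos p1 z = pos p (tperm x y z) by rewrite /pos (eqP (p1E0 z)).
apply: (@leq_trans #|(x, y) |: inversions p1 q|); last first.
  by rewrite cardsU1 -add1n leq_add2r leq_b1.
apply/subset_leq_card/subsetP => -[a b]; rewrite !inE /= xpair_eqE.
case/andP=> pab ->; rewrite andbT !p1E.
have xb := pos_eq p b x; have ya := pos_eq p a y.
have yb := pos_eq p b y; have xa := pos_eq p a x.
move: pab xb ya yb xa.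
by case: tpermP => [->|->|_ _]; case: tpermP => [->|->|_ _]; lia.
Qed.

Lemma inversions_self (V : finType) (p : arrangement V) : inversions p p = set0.
Proof. by apply/setP => x; rewrite !inE; lia. Qed.

Lemma inversions_le_kendall_tau (V : finType) (p q : arrangement V) :
  #|inversions p q| <= kendall_tau p q.
Proof.
rewrite /kendall_tau; case: ex_minnP => m /existsP[[t /= /eqP <-]] + _.
case/andP; elim: t p => [|p1 t IHt] p /=.
  by move=> _ /eqP ->; rewrite inversions_self cards0.
case/andP=> /(@inversions_swap _ _ _ q) le_p path_t last_t.
by apply: leq_trans le_p _; rewrite ltnS IHt.
Qed.

(** Take an inversion whose ends are closest in [p]: any node strictly between them would form a
    closer inversion with one of the ends. *)
Lemma exists_adjacent_inversion (V : finType) (p q : arrangement V) :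
  p != q -> exists x y, pos p y = (pos p x).+1 /\ pos q y < pos q x.
Proof.
move=> neq_pq.
have [xy0 xy0P] : exists xy, xy \in inversions p q.
  apply/set0Pn; apply: contraNneq neq_pq => inv0.
  have lt_pq x y : pos p x < pos p y -> pos q x < pos q y.
    move=> ltxy; have /setP/(_ (x, y)) := inv0; rewrite !inE ltxy /=.
    have := pos_eq q x y; have := pos_eq p x y; lia.
  (* A position is the number of nodes before it, so the order determines the arrangement. *)
  apply/eqP/arrangementP => y; apply: val_inj => /=.
  rewrite -/(pos p y) -/(pos q y) -(card_before p (ltnW (pos_ltn p y))).
  rewrite -(card_before q (ltnW (pos_ltn q y))).
  apply: eq_card => x; rewrite !inE; have := lt_pq x y; have := lt_pq y x.
  have := pos_eq q x y; have := pos_eq p x y; lia.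
have [[x y] xyP min_xy] := @arg_minnP _ xy0 (mem (inversions p q))
  (fun xy => pos p xy.2 - pos p xy.1) xy0P.
have : (x, y) \in inversions p q by [].
rewrite inE /= => /andP[ltxy ltyx]; exists x, y; split=> //.
apply/eqP; rewrite eqn_leq ltxy andbT leqNgt; apply/negP => lt2.
have [z pz] := @pos_surj _ p (pos p x).+1 (ltn_trans lt2 (pos_ltn p y)).
have := min_xy (x, z); have := min_xy (z, y); rewrite !inE /=.
have := pos_eq q x z; have := pos_eq q y z.
have := pos_eq p x z; have := pos_eq p y z; lia.
Qed.

(** Bubble sort: swapping two adjacent nodes that form an inversion removes this inversion and
    creates no other. *)
Lemma kendall_tau_le_inversions (V : finType) (p q : arrangement V) :
  kendall_tau p q <= #|inversions p q|.
Proof.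
suff [t path_t size_t] : exists2 t, path (@adjacent_swap V) p t && (last p t == q)
    & size t <= #|inversions p q|.
  apply: leq_trans size_t; rewrite /kendall_tau; case: ex_minnP => m _; apply.
  by apply/existsP; exists (in_tuple t).
have [m] := ubnP #|inversions p q|; elim: m p => // m IHm p le_m.
have [->|/exists_adjacent_inversion[x [y [pxy qyx]]]] := eqVneq p q.
  by exists [::]; rewrite //= eqxx.
set p1 := relabel (tperm x y) p.
have lt_inv : #|inversions p1 q| < #|inversions p q|.
  apply/proper_card/properP; split; last first.
    by exists (x, y); rewrite !inE /= ?pos_relabel ?tpermL ?tpermR; lia.
  apply/subsetP => -[a b]; rewrite !inE /= !pos_relabel => /andP[+ qba].
  rewrite qba andbT; move: qba.
  have xb := pos_eq p b x; have ya := pos_eq p a y.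
  have yb := pos_eq p b y; have xa := pos_eq p a x.
  have qby := pos_eq q b y; have qax := pos_eq q a x.
  move: xb ya yb xa qby qax.
  by case: tpermP => [->|->|_ _]; case: tpermP => [->|->|_ _]; lia.
have [|t path_t size_t] := IHm p1; first exact: leq_trans lt_inv _.
exists (p1 :: t); last exact: leq_ltn_trans size_t lt_inv.
by rewrite /= adjacent_swap_relabel.
Qed.

Lemma kendall_tau_self (V : finType) (p : arrangement V) : kendall_tau p p = 0.
Proof.
apply/eqP; rewrite -leqn0 -[leqRHS](@cards0 (V * V)%type) -(inversions_self p).
exact: kendall_tau_le_inversions.
Qed.

(** * Relative positions of contiguous blocks *)

Definition between (V : finType) (p : arrangement V) (x z y : V) : bool :=
  (pos p x < pos p z < pos p y) || (pos p y < pos p z < pos p x).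

Definition contiguous (V : finType) (p : arrangement V) (s : seq V) : Prop :=
  forall x y z, x \in s -> y \in s -> pos p x < pos p z < pos p y -> z \in s.

Definition block_between (V : finType) (p : arrangement V) (s1 s2 s3 : seq V) :=
  all (fun x => all (fun z => all (between p x z) s3) s2) s1.

Lemma block_betweenP (V : finType) (p : arrangement V) (s1 s2 s3 : seq V) :
  reflect {in s1 & s2 & s3, forall x z y, between p x z y}
    (block_between p s1 s2 s3).
Proof.
apply: (iffP allP) => [btw x z y s1x s2z s3y|btw x s1x].
  by have /allP/(_ z s2z)/allP/(_ y s3y) := btw x s1x.
by apply/allP => z s2z; apply/allP => y s3y; apply: btw.
Qed.

(** If the blocks were ordered one way at one pair of nodes and the other way at another pair,
    contiguity would put a node of one block into the other. *)
Lemma contiguous_separated (V : finType) (p : arrangement V) (s1 s2 : seq V) :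
  contiguous p s1 -> contiguous p s2 -> {in s1, forall x, x \notin s2} ->
  {in s1 & s2, forall x y, pos p x < pos p y} \/
  {in s1 & s2, forall x y, pos p y < pos p x}.
Proof.
move=> c1 c2 dis.
case: (boolP (all (fun x => all (fun y => pos p x < pos p y) s2) s1)).
  by move/allP => lt; left=> x y /lt/allP/[apply].
case/allPn => x s1x /allPn[y s2y]; rewrite -leqNgt => leyx; right=> x' y' s1x' s2y'.
have ne a b : a \in s1 -> b \in s2 -> pos p a == pos p b = false.
  move=> s1a s2b; rewrite pos_eq; apply: contraNF (dis a s1a).
  by move/eqP->.
have := ne x y s1x s2y; have := ne x' y' s1x' s2y'; have := ne x' y s1x' s2y.
rewrite ltnNge; move=> ne1 ne2 ne3; apply/negP => lexy'.
case: (ltnP (pos p x') (pos p y)) => lt'.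
  by have := dis _ (c1 x' x y s1x' s1x ltac:(lia)); rewrite s2y.
by have := dis _ s1x'; rewrite (c2 y y' x' s2y s2y') //; lia.
Qed.

(** Going round the cycle [s1], [s2], [s3], two of the three comparisons point in the same
    direction, and the block they share is the middle one. The cyclic form suits the later sum over
    rotated triples. *)
Lemma block_between_cycle (V : finType) (p : arrangement V) (s1 s2 s3 : seq V) :
  contiguous p s1 -> contiguous p s2 -> contiguous p s3 ->
  {in s1, forall x, x \notin s2} -> {in s2, forall x, x \notin s3} ->
  {in s3, forall x, x \notin s1} ->
  [|| block_between p s1 s2 s3, block_between p s2 s3 s1
    | block_between p s3 s1 s2].
Proof.
move=> c1 c2 c3 d12 d23 d31.
have btwI (t1 t2 t3 : seq V) :
    {in t1 & t2, forall x y, pos p x < pos p y} ->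
    {in t2 & t3, forall x y, pos p x < pos p y} -> block_between p t1 t2 t3.
  move=> lt12 lt23; apply/block_betweenP => x z y t1x t2z t3y.
  by rewrite /between lt12 // lt23.
have btwD (t1 t2 t3 : seq V) :
    {in t1 & t2, forall x y, pos p y < pos p x} ->
    {in t2 & t3, forall x y, pos p y < pos p x} -> block_between p t1 t2 t3.
  move=> lt12 lt23; apply/block_betweenP => x z y t1x t2z t3y.
  by rewrite /between (lt12 x z) // (lt23 z y) // orbT.
have [lt12|lt12] := contiguous_separated c1 c2 d12;
have [lt23|lt23] := contiguous_separated c2 c3 d23;
have [lt31|lt31] := contiguous_separated c3 c1 d31;
  first [by rewrite (btwI s1 s2 s3) | by rewrite (btwI s2 s3 s1) ?orbT
    | by rewrite (btwI s3 s1 s2) ?orbT | by rewrite (btwD s1 s2 s3)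
    | by rewrite (btwD s2 s3 s1) ?orbT | by rewrite (btwD s3 s1 s2) ?orbT].
Qed.

(** * Inversions forced by joining two blocks *)

Definition inverted (V : finType) (p q : arrangement V) (x y : V) : bool :=
  ((x, y) \in inversions p q) || ((y, x) \in inversions p q).

(** To leave the gap between [x] and [y], the node [z] has to cross one of them. *)
Lemma inverted_between (V : finType) (p q : arrangement V) (x z y : V) :
  between p x z y -> ~~ between q x z y -> inverted p q z x || inverted p q z y.
Proof.
rewrite /inverted !inE /between /=.
have := pos_eq q x z; have := pos_eq q y z.
have := pos_eq p x z; have := pos_eq p y z; lia.
Qed.

Lemma sum_bool_count (T : Type) (a : pred T) (s : seq T) :
  \sum_(x <- s) a x = count a s.
Proof. by rewrite -sum1_count [RHS]big_mkcond; apply: eq_bigr => x _; case: a. Qed.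

Lemma sum_inverted_le (V : finType) (p q : arrangement V) (s t : seq V) :
  uniq (s ++ t) ->
  \sum_(z <- t) \sum_(x <- s) inverted p q z x <= kendall_tau p q.
Proof.
rewrite cat_uniq => /and3P[uniq_s /hasPn dis uniq_t].
apply: leq_trans (inversions_le_kendall_tau p q).
rewrite big_uniq //=; under eq_bigr do rewrite big_uniq //=.
rewrite pair_big /=.
set D := [set zx | [&& zx.1 \in t, zx.2 \in s & inverted p q zx.1 zx.2]].
have -> : \sum_(zx | (zx.1 \in t) && (zx.2 \in s)) inverted p q zx.1 zx.2 = #|D|.
  rewrite -sum1_card (eq_bigl _ _ (fun zx => in_set _ zx)).
  rewrite [RHS](eq_bigl _ _ (fun zx => andbA _ _ _)) [RHS]big_mkcondr.
  by apply: eq_bigr => zx _; case: inverted.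
(* [f] orients a pair from left to right in [p], which makes it an ordered inversion. No two pairs
   of [D] collide, because [s] and [t] are disjoint. *)
pose f (zx : V * V) := if pos p zx.1 < pos p zx.2 then zx else (zx.2, zx.1).
have inj_f : {in D &, injective f}.
  move=> [z x] [z' x']; rewrite !inE /= => /and3P[tz sx _] /and3P[tz' sx' _].
  rewrite /f /=; case: ifP; case: ifP => _ _ [e1 e2]; rewrite ?e1 ?e2 //.
    by move: (dis z tz); rewrite /= e1 sx'.
  by move: (dis z tz); rewrite /= e2 sx'.
rewrite -(card_in_imset inj_f); apply/subset_leq_card/subsetP => _ /imsetP[[z x] + ->].
rewrite inE => /and3P[_ _]; rewrite /f /inverted !inE /=.
by case: (ltnP (pos p z) (pos p x)) => /=; lia.
Qed.

(** In [q] no node [z] of another block lies inside [s1 ++ s2]. So if [z] fails to cross some node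
    of [s1], it crosses all of [s2]; either way it takes part in at least [L] inversions, and a
    block has [L] such nodes. *)
Lemma block_between_cost (V : finType) (p q : arrangement V) (s1 s2 : seq V)
    (ls : seq (seq V)) (L : nat) :
  uniq ((s1 ++ s2) ++ flatten ls) -> size s1 = L -> size s2 = L ->
  {in ls, forall s, size s = L} -> contiguous q (s1 ++ s2) ->
  L * L * (\sum_(s <- ls) block_between p s1 s s2) <= kendall_tau p q.
Proof.
move=> uniq_s sz1 sz2 sz cq.
apply: leq_trans (sum_inverted_le p q uniq_s).
rewrite big_flatten /= big_distrr /= big_seq [leqRHS]big_seq.
apply: leq_sum => s ls_s; case: block_betweenP => [btw|_]; last by rewrite muln0.
rewrite muln1 -{1}(sz s ls_s) -sum1_size big_distrl /= big_seq [leqRHS]big_seq.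
apply: leq_sum => z s_z; rewrite mul1n big_cat /= !sum_bool_count.
have [all1|/allPn[x s1x Nx]] := boolP (all (inverted p q z) s1).
  by move: all1; rewrite all_count => /eqP ->; rewrite sz1 leq_addr.
suff : all (inverted p q z) s2 by rewrite all_count => /eqP ->; rewrite sz2 leq_addl.
apply/allP => y s2y; have := @inverted_between _ p q x z y (btw x z y s1x s_z s2y).
rewrite (negPf Nx); apply.
have zN : z \notin s1 ++ s2.
  move: uniq_s; rewrite cat_uniq => /and3P[_ /hasPn/(_ z) + _]; apply.
  by apply/flattenP; exists s.
apply: contra zN => /orP[] lt; apply: cq lt; rewrite mem_cat ?s1x ?s2y ?orbT //.
Qed.

(** * Arrangement costs and graphs of blocks *)

(** Unlike [contiguous], this fixes the order inside the block, and so it passes to both halves of a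
    concatenation. *)
Definition laid_out (V : finType) (p : arrangement V) (s : seq V) : Prop :=
  exists a, map (pos p) s = iota a (size s).

Lemma laid_out_catl (V : finType) (p : arrangement V) (s1 s2 : seq V) :
  laid_out p (s1 ++ s2) -> laid_out p s1.
Proof.
case=> a; rewrite map_cat size_cat iotaD => /eqP.
by rewrite eqseq_cat ?size_map ?size_iota // => /andP[/eqP eq_s _]; exists a.
Qed.

Lemma laid_out_catr (V : finType) (p : arrangement V) (s1 s2 : seq V) :
  laid_out p (s1 ++ s2) -> laid_out p s2.
Proof.
case=> a; rewrite map_cat size_cat iotaD => /eqP.
rewrite eqseq_cat ?size_map ?size_iota // => /andP[_ /eqP eq_s].
by exists (a + size s1).
Qed.

Lemma laid_out_mem (V : finType) (p : arrangement V) (s : seq V) (a : nat) x :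
  map (pos p) s = iota a (size s) -> (x \in s) = (a <= pos p x < a + size s).
Proof.
move=> eq_s; rewrite -mem_iota -eq_s mem_map // => y z /eqP.
by rewrite pos_eq => /eqP.
Qed.

Lemma laid_out_contiguous (V : finType) (p : arrangement V) (s : seq V) :
  laid_out p s -> contiguous p s.
Proof. by case=> a /laid_out_mem ms x y z; rewrite !ms; lia. Qed.

(** Each edge is counted in both orientations; one of the two truncated differences is zero, so
    their sum is the distance. *)
Lemma la_cost_double (V : finType) (G : graph V) (p : arrangement V) :
  (la_cost G p).*2 = \sum_x \sum_(y | [set x; y] \in G)
    ((pos p x - pos p y) + (pos p y - pos p x)).
Proof.
rewrite -addnn (pair_big_dep predT (fun x y => [set x; y] \in G)) /= big_split /=.
have le_cost : la_cost G p =
    \sum_(xy | [set xy.1; xy.2] \in G) (pos p xy.2 - pos p xy.1).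
  rewrite /la_cost big_mkcondr; apply: eq_bigr => -[x y] _ /=.
  by rewrite -/(pos p x) -/(pos p y); case: ltnP; lia.
congr (_ + _) => //; rewrite le_cost.
have swapK : involutive (fun xy : V * V => (xy.2, xy.1)) by case.
rewrite (reindex_inj (inv_inj swapK)); apply: eq_bigl => -[x y] /=.
by rewrite finset.setUC.
Qed.

Lemma pos_dist (V : finType) (p : arrangement V) (x y : V) : x != y ->
  (pos p x - pos p y) + (pos p y - pos p x) = 1 + \sum_w between p x w y.
Proof.
rewrite -(pos_eq p) neq_ltn add1n => xy.
have -> : \sum_w between p x w y = #|[set w | between p x w y]|.
  rewrite -sum1_card [RHS]big_mkcond; apply: eq_bigr => w _; rewrite inE.
  by case: between.
case/orP: xy => lt; have gap := pos_gap lt.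
  rewrite (_ : _ - _ + _ = pos p y - pos p x); last by lia.
  by rewrite gap; congr _.+1; apply: eq_card => w; rewrite !inE /between; lia.
rewrite (_ : _ - _ + _ = pos p x - pos p y); last by lia.
by rewrite gap; congr _.+1; apply: eq_card => w; rewrite !inE /between; lia.
Qed.

(** Counts the nodes under an edge that do not form a triangle with its ends. For disjoint cliques
    it vanishes exactly when every clique is contiguous. *)
Definition stretch (V : finType) (G : graph V) (p : arrangement V) : nat :=
  \sum_x \sum_y \sum_w [&& [set x; y] \in G,
    ~~ (([set x; w] \in G) && ([set w; y] \in G)) & between p x w y].

Lemma stretch_eq0 (V : finType) (G : graph V) (p : arrangement V) :
  stretch G p = 0 <-> forall x w y, [set x; y] \in G -> between p x w y ->
    ([set x; w] \in G) && ([set w; y] \in G).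
Proof.
split=> [/eqP str0 x w y Gxy btw|str0].
  move: str0; rewrite sum_nat_eq0 => /forallP/(_ x)/=; rewrite sum_nat_eq0.
  move=> /forallP/(_ y)/=; rewrite sum_nat_eq0 => /forallP/(_ w)/=.
  by rewrite Gxy btw andbT eqb0 negbK.
rewrite /stretch big1 // => x _; rewrite big1 // => y _; rewrite big1 // => w _.
case: (boolP (_ \in G)) => //= Gxy; case: (boolP (between _ _ _ _)) => [btw|].
  by rewrite str0.
by rewrite andbF.
Qed.

Section CliqueCost.
Variables (V : finType) (G : graph V).
Hypothesis G_irr : forall x : V, [set x; x] \notin G.

Let S x y := [set x; y] \in G.
Let triangle x w y := [&& S x y, S x w & S w y].
(* An edge xy costs 1 plus the number of nodes between x and y. Each triangle has
   exactly one node in the middle, so the contribution of the nodes adjacent to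
   both ends does not depend on [p]; only the [stretch] does. The factor 6
   accounts for the orientation of the edges and the rotations of the
   triangles. *)
Lemma clique_cost p :
  la_cost G p * 6 = 3 * (\sum_x \sum_y S x y) +
    \sum_x \sum_y \sum_w triangle x w y + 3 * stretch G p.
Proof.
pose inner := \sum_x \sum_y \sum_w (triangle x w y && between p x w y).
have Ssym x y : S x y = S y x by rewrite /S finset.setUC.
have cost_split : (la_cost G p).*2 = \sum_x \sum_y S x y + inner + stretch G p.
  rewrite la_cost_double -!big_split /=; apply: eq_bigr => x _.
  rewrite big_mkcond -!big_split /=; apply: eq_bigr => y _.
  rewrite -/(S x y); case: (boolP (S x y)) => [Sxy|NS].
    rewrite pos_dist; last by apply: contraTneq Sxy => ->; apply: G_irr.
    rewrite -addnA; congr (_ + _).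
    rewrite -big_split; apply: eq_bigr => w _; rewrite /triangle Sxy /=.
    by case: (S x w && S w y) => //=; rewrite addn0.
  rewrite add0n -big_split big1 // => w _.
  by rewrite /triangle (negPf NS).
suff : inner * 3 = \sum_x \sum_y \sum_w triangle x w y by lia.
have rot (F : V -> V -> V -> nat) :
    \sum_x \sum_y \sum_w F x w y = \sum_x \sum_y \sum_w F w y x.
  by rewrite exchange_big; apply: eq_bigr => c _; rewrite exchange_big.
pose f x w y : nat := triangle x w y && between p x w y.
have -> : inner * 3 = \sum_x \sum_y \sum_w (f x w y + f w y x + f y x w).
  have r1 : \sum_x \sum_y \sum_w f w y x = inner := esym (rot f).
  have r2 : \sum_x \sum_y \sum_w f y x w = inner :=
    etrans (esym (rot (fun x w y => f w y x))) r1.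
  transitivity (inner + inner + inner); first by lia.
  rewrite -{2}r1 -{2}r2 /inner -!big_split /=; apply: eq_bigr => x _.
  by rewrite -!big_split /=; apply: eq_bigr => y _; rewrite -!big_split.
apply: eq_bigr => x _; apply: eq_bigr => y _; apply: eq_bigr => w _.
rewrite /f (_ : triangle w y x = triangle x w y); last first.
  by rewrite /triangle (Ssym w x) (Ssym y x); do 3!case: (S _ _).
rewrite (_ : triangle y x w = triangle x w y); last first.
  by rewrite /triangle (Ssym y x) (Ssym y w); do 3!case: (S _ _).
case: (boolP (triangle x w y)) => //= /and3P[Sxy Sxw Swy].
have ne a b : S a b -> pos p a == pos p b = false.
  by rewrite pos_eq => Sab; apply: contraTF Sab => /eqP ->; apply: G_irr.
rewrite /between; have := ne _ _ Sxy; have := ne _ _ Sxw; have := ne _ _ Swy; lia.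
Qed.

(** By [clique_cost], the costs of two arrangements differ by half the difference of their
    stretches. *)
Lemma stretch_eq0_minla p : stretch G p = 0 -> minla G p.
Proof.
move=> str0; apply/forallP => q.
by have := clique_cost p; have := clique_cost q; rewrite str0; lia.
Qed.

Lemma minla_stretch_eq0 p q : stretch G q = 0 -> minla G p -> stretch G p = 0.
Proof.
move=> str0 /forallP/(_ q).
by have := clique_cost p; have := clique_cost q; rewrite str0; lia.
Qed.
End CliqueCost.

(** * Cliques and paths given by lists of nodes *)

Lemma bigcup_seqP (T : finType) (I : eqType) (F : I -> {set T}) (r : seq I) e :
  reflect (exists2 s, s \in r & e \in F s) (e \in \bigcup_(s <- r) F s).
Proof.
elim: r => [|s r IHr]; first by rewrite big_nil inE; constructor; case.
rewrite big_cons inE; apply: (iffP orP).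
  case=> [Fs|/IHr[t rt Ft]]; first by exists s; rewrite ?mem_head.
  by exists t; rewrite // inE rt orbT.
case=> t; rewrite inE => /predU1P[-> Fs|rt Ft]; first by left.
by right; apply/IHr; exists t.
Qed.

Lemma mem_clique_edges (V : finType) (B : {set V}) (x y : V) :
  ([set x; y] \in clique_edges B) = [&& x \in B, y \in B & x != y].
Proof.
rewrite inE cards2 finset.subUset !finset.sub1set -andbA.
by case: (x != y).
Qed.

Lemma path_edges_cons2 (V : finType) (x y : V) (s : seq V) :
  path_edges (x :: y :: s) = [set x; y] |: path_edges (y :: s).
Proof.
apply/setP => e; rewrite !inE; apply/imsetP/orP.
  case=> /= -[a b]; rewrite inE => /predU1P[[-> ->] ->|ab ->]; first by left.
  by right; apply/imsetP; exists (a, b).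
case=> [/eqP->|/imsetP[ab abP ->]]; first by exists (x, y); rewrite /= ?mem_head.
by exists ab; rewrite //= inE abP orbT.
Qed.

Lemma path_edges_short (V : finType) (s : seq V) :
  size s < 2 -> path_edges s = finset.set0.
Proof.
by case: s => [|x [|//]] _; apply/setP => e; rewrite !inE; apply/imsetP => -[].
Qed.

Lemma path_edgesP (V : finType) (s : seq V) (e : {set V}) :
  reflect (exists s1 x y s2, s = s1 ++ [:: x, y & s2] /\ e = [set x; y])
    (e \in path_edges s).
Proof.
elim: s => [|x [|y s] IHs].
- rewrite path_edges_short // inE; by constructor=> -[[|? ?] [? [? [? []]]]].
- rewrite path_edges_short // inE; by constructor=> -[[|? [|? ?]] [? [? [? []]]]].
rewrite path_edges_cons2 in_setU1; apply: (iffP predU1P).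
  case=> [->|/IHs[s1 [a [b [s2 [-> ->]]]]]]; first by exists [::], x, y, s.
  by exists (x :: s1), a, b, s2.
case=> -[|z s1] [a [b [s2 []]]]; first by case=> -> -> _ ->; left.
by case=> _ eq_s eq_e; right; apply/IHs; exists s1, a, b, s2.
Qed.

(** A list serves as a block in both classes: a path follows its order, a clique sees only its set
    of nodes. *)
Definition block_edges (cls : instance_class) (V : finType) (s : seq V) : graph V :=
  match cls with
  | Cliques => clique_edges [set x in s]
  | Lines => path_edges s
  end.

Definition block_graph (cls : instance_class) (V : finType) (bs : seq (seq V)) :
  graph V := \bigcup_(s <- bs) block_edges cls s.

Lemma mem_block_edges (cls : instance_class) (V : finType) (s : seq V) e :
  uniq s -> e \in block_edges cls s ->
  exists x y, [/\ e = [set x; y], x \in s, y \in s & x != y].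
Proof.
move=> uniq_s; case: cls => /=.
  rewrite inE => /andP[/subsetP se /cards2P[x [y [xy def_e]]]]; exists x, y.
  have := se x; have := se y; rewrite def_e !inE !eqxx orbT /=.
  by move=> -> // -> //; split.
case/path_edgesP=> s1 [x [y [s2 [def_s ->]]]]; exists x, y; split=> //.
- by rewrite def_s mem_cat mem_head orbT.
- by rewrite def_s mem_cat !inE eqxx !orbT.
by move: uniq_s; rewrite def_s cat_uniq => /and3P[_ _ /andP[+ _]]; rewrite inE; case: eqP.
Qed.

Lemma uniq_flatten_eq (T : eqType) (bs : seq (seq T)) (s t : seq T) x :
  uniq (flatten bs) -> s \in bs -> t \in bs -> x \in s -> x \in t -> s = t.
Proof.
elim: bs => //= b bs IHbs; rewrite cat_uniq => /and3P[_ /hasPn dis uniq_bs].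
have disb u : u \in bs -> x \in b -> x \in u -> False.
  by move=> bs_u bx ux; have /dis/negP := (introT flattenP (ex_intro2 _ _ u bs_u ux)).
rewrite !inE => /predU1P[->|bs_s] /predU1P[->|bs_t] // sx tx; last exact: IHbs.
  by case: (disb t).
by case: (disb s).
Qed.

Lemma uniq_flatten_mem (T : eqType) (bs : seq (seq T)) (s : seq T) :
  uniq (flatten bs) -> s \in bs -> uniq s.
Proof.
elim: bs => //= b bs IHbs; rewrite cat_uniq inE => /and3P[ub _ ubs].
by case/predU1P=> [->|/IHbs->].
Qed.

(** * Merging blocks *)

Lemma block_edge_ends (cls : instance_class) (V : finType) (s : seq V) x y :
  uniq s -> [set x; y] \in block_edges cls s -> [/\ x \in s, y \in s & x != y].
Proof.
move=> uniq_s /(mem_block_edges uniq_s)[a [b [def_e sa sb ab]]].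
have /orP x_ab : (x == a) || (x == b) by rewrite -in_set2 -def_e !inE eqxx.
have /orP y_ab : (y == a) || (y == b) by rewrite -in_set2 -def_e !inE eqxx orbT.
split; first by case: x_ab => /eqP->.
  by case: y_ab => /eqP->.
apply: contraNneq ab => xy.
have := set21 a b; have := set22 a b; rewrite -def_e xy !inE !orbb.
by move=> /eqP-> /eqP->.
Qed.

(** Every edge stays inside one block and the blocks are disjoint, so a walk never leaves its
    block. *)
Lemma connect_block (cls : instance_class) (V : finType) (bs : seq (seq V))
    (s : seq V) x y :
  uniq (flatten bs) -> s \in bs -> x \in s ->
  connect (adjacent (block_graph cls bs)) x y -> y \in s.
Proof.
move=> uniq_bs bs_s sx /connectP[p + ->]; elim: p x sx => //= z p IHp x sx.
case/andP=> /bigcup_seqP[t bs_t]; have uniq_t := uniq_flatten_mem uniq_bs bs_t.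
case/(block_edge_ends uniq_t) => tx tz _; apply: IHp.
by rewrite (uniq_flatten_eq uniq_bs bs_s bs_t sx tx).
Qed.

Lemma block_edge_irr (cls : instance_class) (V : finType) (bs : seq (seq V)) x :
  uniq (flatten bs) -> [set x; x] \notin block_graph cls bs.
Proof.
move=> uniq_bs; apply/bigcup_seqP=> -[s bs_s].
by case/(block_edge_ends (uniq_flatten_mem uniq_bs bs_s)); rewrite eqxx.
Qed.

Lemma class_graph_cover (cls : instance_class) (V : finType) (ss : seq (seq V)) :
  perm_eq (flatten ss) (enum V) -> class_graph cls (block_graph cls ss).
Proof.
move=> cover_ss; case: cls; last by exists ss.
have uniq_ss : uniq (flatten ss) by rewrite (perm_uniq cover_ss) enum_uniq.
(* Empty blocks are left out, since a partition has no empty part. *)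
pose P := [set B | has (fun s => (s != [::]) && (B == [set z in s])) ss].
have PP B : reflect (exists s, [/\ s \in ss, s != [::] & B = [set z in s]]) (B \in P).
  rewrite inE; apply: (iffP hasP) => [[s ss_s /andP[s0 /eqP->]]|[s [ss_s s0 ->]]].
    by exists s.
  by exists s; rewrite // s0 eqxx.
exists P.
  apply/and3P; split.
  - apply/eqP/setP => x; rewrite inE; apply/bigcupP.
    have /flattenP[s ss_s sx] : x \in flatten ss.
      by rewrite (perm_mem cover_ss) mem_enum.
    exists [set z in s]; last by rewrite inE.
    by apply/PP; exists s; split=> //; apply: contraTneq sx => ->.
  - apply/trivIsetP => A B /PP[s [ss_s _ ->]] /PP[t [ss_t _ ->]].
    apply: contraR => /pred0Pn[x /andP[]]; rewrite !inE => sx tx.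
    by rewrite (uniq_flatten_eq uniq_ss ss_s ss_t sx tx).
  - by apply/PP=> -[[|x s] [_ // _ /setP/(_ x)]]; rewrite !inE eqxx.
apply/setP => e; apply/bigcup_seqP/bigcupP => [[s ss_s es]|[B /PP[s [ss_s _ ->]] es]].
  exists [set z in s] => //; apply/PP; exists s; split=> //.
  have [x [_ [_ sx _ _]]] := @mem_block_edges Cliques _ _ _ (uniq_flatten_mem uniq_ss ss_s) es.
  by apply: contraTneq sx => ->.
by exists s.
Qed.

Lemma block_edges_short (cls : instance_class) (V : finType) (s : seq V) :
  size s < 2 -> block_edges cls s = finset.set0.
Proof.
case: s => [|x [|//]] _; apply/setP => e; rewrite inE; apply/negP => es.
  by have [|? [? []]] := mem_block_edges _ es.
have [|a [b []]] := mem_block_edges _ es => //.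
by move=> _; rewrite !inE => /eqP-> /eqP->; rewrite eqxx.
Qed.

Lemma class_graph_blocks (cls : instance_class) (V : finType) (bs : seq (seq V)) :
  uniq (flatten bs) -> class_graph cls (block_graph cls bs).
Proof.
move=> uniq_bs; pose r := [seq x <- enum V | x \notin flatten bs].
(* Unlisted nodes become singleton blocks, which add no edge but complete the cover of [V]. *)
have -> : block_graph cls bs = block_graph cls (bs ++ [seq [:: x] | x <- r]).
  rewrite /block_graph big_cat /= [X in _ :|: X]big1_seq ?finset.setU0 //= => s.
  by case/mapP=> x _ ->; rewrite block_edges_short.
apply: class_graph_cover; rewrite flatten_cat (flatten_map1 id) map_id.
apply: uniq_perm; rewrite ?enum_uniq //.
  rewrite cat_uniq uniq_bs filter_uniq ?enum_uniq //= andbT; apply/hasPn => x.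
  by rewrite mem_filter => /andP[].
by move=> x; rewrite mem_cat mem_filter mem_enum /= andbT orbN.
Qed.

Lemma block_graph_perm (cls : instance_class) (V : finType) (bs cs : seq (seq V)) :
  perm_eq bs cs -> block_graph cls bs = block_graph cls cs.
Proof. exact: perm_big. Qed.

Lemma path_edges_cat (V : finType) (x y : V) (s1 s2 : seq V) :
  path_edges (rcons s1 x ++ y :: s2) =
  [set x; y] |: (path_edges (rcons s1 x) :|: path_edges (y :: s2)).
Proof.
elim: s1 => [|z s1 IHs] /=.
  by rewrite path_edges_cons2 (@path_edges_short _ [:: x]) ?finset.set0U.
case: s1 IHs => [|u s1] /= IHs; rewrite !path_edges_cons2 ?IHs.
  by rewrite (@path_edges_short _ [:: x]) // finset.setU0 finset.setUCA.
by rewrite -!finset.setUA finset.setUCA.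
Qed.

Lemma clique_edges_cat (V : finType) (s1 s2 : seq V) :
  (forall a b, a \in s1 -> b \in s2 -> a != b) ->
  clique_edges [set w in s1 ++ s2] = clique_edges [set w in s1] :|:
    clique_edges [set w in s2] :|:
    [set [set a; b] | a in [set w in s1], b in [set w in s2]].
Proof.
move=> dis.
apply/setP => e; apply/idP/idP => [|].
  move=> /[dup]; rewrite {1}inE => /andP[_ /cards2P[a [b [ab ->]]]].
  rewrite !finset.in_setU !mem_clique_edges !inE !mem_cat ab !andbT.
  case t1a: (a \in s1); case t1b: (b \in s1); rewrite ?orbT //=.
  - by move=> t2b; apply/orP; right; apply/imset2P; exists a b; rewrite ?inE.
  - move=> /andP[t2a _]; rewrite andbC; apply/orP; right; apply/imset2P.
    by exists b a; rewrite ?inE // finset.setUC.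
  - by move=> ->.
rewrite !inE => /orP[/orP[]|/imset2P[a b]]; rewrite ?inE.
- case/andP=> /subsetP st ->; rewrite andbT; apply/subsetP => z /st.
  by rewrite !inE mem_cat => ->.
- case/andP=> /subsetP st ->; rewrite andbT; apply/subsetP => z /st.
  by rewrite !inE mem_cat => ->; rewrite orbT.
move=> t1a t2b ->; rewrite cards2 dis // finset.subUset !finset.sub1set.
by rewrite !inE !mem_cat t1a t2b orbT.
Qed.

(** Concatenation is one step of either class. The witnesses are the last node of [s1] and the first
    node of [s2]: for lines they are the ends of the new edge, for cliques their components are the
    two merged cliques. *)
Lemma class_step_merge (cls : instance_class) (V : finType) (s1 s2 : seq V)
    (bs : seq (seq V)) :
  uniq (flatten [:: s1, s2 & bs]) -> s1 != [::] -> s2 != [::] ->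
  class_step cls (block_graph cls [:: s1, s2 & bs])
    (block_graph cls ((s1 ++ s2) :: bs)).
Proof.
move=> uniq_bs; case/lastP: s1 uniq_bs => // s1 x uniq_bs _.
case: s2 uniq_bs => // y s2 uniq_bs _.
set t1 := rcons s1 x in uniq_bs *; set t2 := y :: s2 in uniq_bs *.
have t1x : x \in t1 by rewrite mem_rcons mem_head.
have t2y : y \in t2 by rewrite mem_head.
set bs1 := [:: t1, t2 & bs] in uniq_bs *.
have bs_t1 : t1 \in bs1 by rewrite mem_head.
have bs_t2 : t2 \in bs1 by rewrite !inE eqxx orbT.
have dis21 b : b \in t2 -> b \notin t1.
  have : uniq ((t1 ++ t2) ++ flatten bs) by rewrite -catA.
  rewrite cat_uniq cat_uniq => /andP[/and3P[_ /hasPn dis _] _]; exact: dis.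
have Nxy : ~~ connect (adjacent (block_graph cls bs1)) x y.
  apply/negP => /(connect_block uniq_bs bs_t1 t1x) t1y.
  by have := dis21 y t2y; rewrite t1y.
case: cls Nxy => Nxy; exists x, y; split=> //; last first.
  by rewrite /block_graph !big_cons /= path_edges_cat -!finset.setUA.
have compE t z : t \in bs1 -> z \in t ->
    component (block_graph Cliques bs1) z = [set w in t].
  move=> bs_t tz; apply/setP => w; rewrite !inE.
  apply/idP/idP => [/(connect_block uniq_bs bs_t tz) //|tw].
  have [->|zw] := eqVneq z w; first exact: connect0.
  apply: connect1; apply/bigcup_seqP; exists t => //=.
  by rewrite mem_clique_edges !inE tz tw zw.
rewrite (compE t1) // (compE t2) // /block_graph !big_cons /=.
have dis a b : a \in t1 -> b \in t2 -> a != b.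
  by move=> t1a t2b; apply: contraTneq t1a => ->; apply: dis21.
by rewrite clique_edges_cat // -!finset.setUA; congr (_ :|: (_ :|: _)); exact: finset.setUC.
Qed.

(** * Blocks in minimum linear arrangements *)

(** Every edge has the least possible length. For collections of paths this is attainable, hence
    characterizes their MinLAs. *)
Definition edges_tight (V : finType) (G : graph V) (p : arrangement V) : Prop :=
  forall x y, [set x; y] \in G -> (pos p x - pos p y) + (pos p y - pos p x) = 1.

(** The bound shows that tight arrangements are optimal; its equality case shows that optimal ones
    are tight as soon as a tight one exists. *)
Lemma la_cost_leqif (V : finType) (G : graph V) (p : arrangement V) :
  (forall x, [set x; x] \notin G) ->
  \sum_(xy : V * V | [set xy.1; xy.2] \in G) 1 <= (la_cost G p).*2
    ?= iff [forall (xy : V * V | [set xy.1; xy.2] \in G),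
      1 == (pos p xy.1 - pos p xy.2) + (pos p xy.2 - pos p xy.1)].
Proof.
move=> G_irr; rewrite la_cost_double pair_big_dep /=.
apply: leqif_sum => -[x y] /= Gxy; split=> //.
have : x != y by apply: contraTneq Gxy => ->; apply: G_irr.
by rewrite -(pos_eq p); lia.
Qed.

Lemma edges_tight_cost (V : finType) (G : graph V) (q : arrangement V) :
  edges_tight G q -> (la_cost G q).*2 = \sum_(xy : V * V | [set xy.1; xy.2] \in G) 1.
Proof.
move=> tight; rewrite la_cost_double pair_big_dep /=.
by apply: eq_bigr => -[x y] /= /tight.
Qed.

Lemma edges_tight_minla (V : finType) (G : graph V) (q : arrangement V) :
  (forall x, [set x; x] \notin G) -> edges_tight G q -> minla G q.
Proof.
move=> G_irr /edges_tight_cost cost_q; apply/forallP => p.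
by have [] := la_cost_leqif p G_irr; rewrite -cost_q leq_double.
Qed.

Lemma minla_edges_tight (V : finType) (G : graph V) (p q : arrangement V) :
  (forall x, [set x; x] \notin G) -> edges_tight G q -> minla G p ->
  edges_tight G p.
Proof.
move=> G_irr /edges_tight_cost cost_q /forallP/(_ q) le_pq x y Gxy.
have [] := la_cost_leqif p G_irr.
rewrite -cost_q leq_double => le_qp; have -> : la_cost G p = la_cost G q by lia.
by rewrite eqxx => /esym/forallP/(_ (x, y))/=; rewrite Gxy => /eqP.
Qed.

(** A discrete intermediate value theorem: a sequence moving by unit steps skips no value. *)
Lemma unit_steps_mem (l : seq nat) (a b m : nat) :
  sorted (fun u v => (u - v) + (v - u) == 1) l ->
  a \in l -> b \in l -> a <= m <= b -> m \in l.
Proof.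
elim: l a b => // x l IHl a b.
have [->|xm] := eqVneq x m; first by rewrite mem_head.
move=> path_l la lb leamb; rewrite in_cons [m == x]eq_sym (negPf xm) /=.
have [lt_xm|lt_mx] := ltnP x m.
  have lb' : b \in l by move: lb; rewrite inE => /predU1P[eq_b|//]; lia.
  case: l IHl path_l la lb lb' => // y l IHl /= /andP[xy path_l] la lb lb'.
  by rewrite (IHl y b) ?mem_head ?orbT //; lia.
have la' : a \in l by move: la; rewrite inE => /predU1P[eq_a|//]; lia.
case: l IHl path_l la lb la' => // y l IHl /= /andP[xy path_l] la lb la'.
by rewrite (IHl a y) ?mem_head ?orbT //; lia.
Qed.

Lemma edges_tight_contiguous (V : finType) (s : seq V) (p : arrangement V) :
  edges_tight (path_edges s) p -> contiguous p s.
Proof.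
move=> tight x y z sx sy lt_xzy.
suff : pos p z \in map (pos p) s.
  by rewrite mem_map // => u v /eqP; rewrite pos_eq => /eqP.
(* The positions read along a tight path change by one at each edge. *)
apply: (@unit_steps_mem _ (pos p x) (pos p y)); rewrite ?map_f //; last by lia.
elim: s {x y z sx sy lt_xzy} tight => // x [|y s] IHs tight //.
rewrite /= tight; last by rewrite path_edges_cons2 finset.setU11.
apply: IHs => u v uv; apply: tight.
by rewrite path_edges_cons2 finset.setU1r.
Qed.

Lemma set2_eq (T : finType) (x y a b : T) :
  [set x; y] = [set a; b] -> x = a /\ y = b \/ x = b /\ y = a.
Proof.
move=> eq2; have := set21 x y; have := set22 x y; rewrite {1 2}eq2.
have := set21 a b; have := set22 a b; rewrite -{1 2}eq2 !inE.
by do 4!case/orP=> /eqP ?; subst; auto.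
Qed.

Lemma laid_out_edges_tight (V : finType) (s : seq V) (p : arrangement V) :
  laid_out p s -> edges_tight (path_edges s) p.
Proof.
move=> lay_s x y /path_edgesP[s1 [a [b [s2 [def_s]]]]].
have ab : pos p b = (pos p a).+1.
  by move: lay_s; rewrite def_s => /laid_out_catr[c [-> -> _]].
move=> def_xy.
by case: (set2_eq def_xy) => -[-> ->]; rewrite ab; lia.
Qed.

Lemma arrangement_exists (V : finType) (f : V -> nat) :
  injective f -> (forall x, f x < #|V|) ->
  exists q : arrangement V, forall x, pos q x = f x.
Proof.
move=> inj_f lt_f.
have inj_g : injectiveb [ffun x => Ordinal (lt_f x)].
  by apply/injectiveP => x y; rewrite !ffunE => -[/inj_f].
pose q : arrangement V := exist (fun p : {ffun V -> 'I_#|V|} => injectiveb p) _ inj_g.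
by exists q => x; rewrite /pos /position /= ffunE.
Qed.

Lemma map_index_uniq (T : eqType) (s t : seq T) : uniq s ->
  map (fun x => index x (s ++ t)) s = iota 0 (size s).
Proof.
elim: s => //= x s IHs /andP[Nsx uniq_s]; rewrite eqxx; congr (_ :: _).
rewrite (iotaDl 1 0) -IHs // -map_comp; apply/eq_in_map => y sy /=.
by case: eqP => // xy; rewrite xy sy in Nsx.
Qed.

Lemma laid_out_block (V : finType) (q : arrangement V) (bs : seq (seq V)) s :
  laid_out q (flatten bs) -> s \in bs -> laid_out q s.
Proof.
move=> lay bs_s; case/splitPr: bs_s lay => b1 b2.
by rewrite flatten_cat => /laid_out_catr/laid_out_catl.
Qed.

Lemma exists_laid_out (V : finType) (bs : seq (seq V)) :
  uniq (flatten bs) ->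
  exists q : arrangement V, forall s, s \in bs -> laid_out q s.
Proof.
(* [t] lists the blocks one after another and then all other nodes; the arrangement sends a node to
   its index in [t]. *)
move=> uniq_bs; pose t := flatten bs ++ [seq x <- enum V | x \notin flatten bs].
have t_all x : x \in t by rewrite mem_cat mem_filter mem_enum andbT orbN.
have uniq_t : uniq t.
  rewrite cat_uniq uniq_bs filter_uniq ?enum_uniq // andbT; apply/hasPn => x.
  by rewrite mem_filter => /andP[].
have size_t : size t = #|V|.
  rewrite cardE; apply/perm_size/uniq_perm; rewrite ?enum_uniq // => x.
  by rewrite t_all mem_enum.
have [|x|q qE] := @arrangement_exists V (fun x => index x t).
- by move=> x y eq_xy; rewrite -(nth_index x (t_all x)) eq_xy nth_index.
- by rewrite -size_t index_mem.
exists q => s; apply: laid_out_block; exists 0.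
by rewrite -(@map_index_uniq _ _ [seq x <- enum V | x \notin flatten bs]) //;
   apply: eq_map.
Qed.


Lemma laid_out_stretch (V : finType) (bs : seq (seq V)) (q : arrangement V) :
  uniq (flatten bs) -> (forall s, s \in bs -> laid_out q s) ->
  stretch (block_graph Cliques bs) q = 0.
Proof.
move=> uniq_bs lay; apply/stretch_eq0 => x w y /bigcup_seqP[s bs_s].
rewrite mem_clique_edges !inE => /and3P[sx sy xy] btw.
have contig := laid_out_contiguous (lay s bs_s).
have sw : w \in s.
  by case/orP: btw => lt; [apply: contig sx sy lt | apply: contig sy sx lt].
have [xw wy] : x != w /\ w != y.
  by rewrite -!(pos_eq q); move: btw; rewrite /between; lia.
by apply/andP; split; apply/bigcup_seqP; exists s;
   rewrite //= mem_clique_edges !inE ?sx ?sw ?sy.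
Qed.

Lemma minla_laid_out (cls : instance_class) (V : finType) (bs : seq (seq V))
    (q : arrangement V) :
  uniq (flatten bs) -> (forall s, s \in bs -> laid_out q s) ->
  minla (block_graph cls bs) q.
Proof.
move=> uniq_bs lay; case: cls.
  apply: stretch_eq0_minla (laid_out_stretch uniq_bs lay) => x.
  exact: block_edge_irr.
apply: edges_tight_minla => [x|x y /bigcup_seqP[s bs_s]].
  exact: block_edge_irr.
exact/laid_out_edges_tight/lay.
Qed.

(** Laying out all blocks attains zero stretch for cliques and unit edges for lines. Hence every
    MinLA attains it as well, and both properties force contiguity. *)
Lemma minla_contiguous (cls : instance_class) (V : finType) (bs : seq (seq V))
    (p : arrangement V) (s : seq V) :
  uniq (flatten bs) -> minla (block_graph cls bs) p -> s \in bs ->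
  contiguous p s.
Proof.
move=> uniq_bs min_p bs_s.
have G_irr x : [set x; x] \notin block_graph cls bs by exact: block_edge_irr.
have [q lay] := exists_laid_out uniq_bs.
case: cls min_p G_irr => min_p G_irr; last first.
  apply: edges_tight_contiguous => x y sxy.
  have tight : edges_tight (block_graph Lines bs) q.
    by move=> u v /bigcup_seqP[t bs_t]; apply: (laid_out_edges_tight (lay t bs_t)).
  by apply: (minla_edges_tight G_irr tight min_p); apply/bigcup_seqP; exists s.
have /stretch_eq0 str0 := minla_stretch_eq0 G_irr (laid_out_stretch uniq_bs lay) min_p.
move=> x y z sx sy lt.
have xy : x != y by rewrite -(pos_eq p); lia.
have Gxy : [set x; y] \in block_graph Cliques bs.
  by apply/bigcup_seqP; exists s; rewrite //= mem_clique_edges !inE sx sy.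
have /andP[] := str0 x z y Gxy (introT orP (or_introl lt)).
case/bigcup_seqP=> t bs_t; rewrite mem_clique_edges !inE => /and3P[tx tz _] _.
by rewrite (uniq_flatten_eq uniq_bs bs_s bs_t sx tx).
Qed.

(** * Instances and their optimum *)

(** Only the nodes of [s], which fill the first positions of [p], are permuted among themselves, so
    every inversion lies in the square of [s]. *)
Lemma rearranged_prefix (V : finType) (p : arrangement V) (s : seq V) :
  uniq s -> (forall x, (x \in s) = (pos p x < size s)) ->
  exists2 q, laid_out q s & kendall_tau p q <= size s * size s.
Proof.
move=> uniq_s sP; pose f x := if x \in s then index x s else pos p x.
have [x y|x|q qE] := @arrangement_exists V f.
- rewrite /f; case: ifP => sx; case: ifP => sy.
  + by move=> eq_xy; rewrite -(nth_index x sx) eq_xy nth_index.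
  + by move=> eq_xy; move: sx sy; rewrite -index_mem eq_xy sP => ->.
  + by move=> eq_xy; move: sy sx; rewrite -index_mem -eq_xy sP => ->.
  + by move/eqP; rewrite pos_eq => /eqP.
- rewrite /f; case: ifP => sx; last exact: pos_ltn.
  apply: leq_trans (_ : size s <= _); first by rewrite index_mem.
  by rewrite cardE; apply: uniq_leq_size => // y _; rewrite mem_enum.
have qs x : x \in s -> pos q x < size s by move=> sx; rewrite qE /f sx index_mem.
have qNs x : x \notin s -> pos q x = pos p x.
  by move=> Nsx; rewrite qE /f (negPf Nsx).
exists q.
  exists 0; have := @map_index_uniq _ s [::] uniq_s; rewrite cats0 => <-.
  by apply/eq_in_map => x sx; rewrite qE /f sx.
apply: leq_trans (kendall_tau_le_inversions p q) _.
have card_s : #|[set x in s]| = size s by rewrite cardsE; apply/card_uniqP.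
rewrite -card_s -cardsX; apply/subset_leq_card/subsetP => -[x y].
rewrite !inE /= => /andP[ltp ltq].
have sy : y \in s.
  apply: contraLR ltq => Nsy; rewrite -leqNgt (qNs y) //; move: Nsy; rewrite sP.
  case sx: (x \in s); first by have := qs x sx; lia.
  by rewrite qNs ?sx //; lia.
by rewrite sy andbT sP; move: sy; rewrite sP; lia.
Qed.

(** The solution moves to [q] in the first step and stays there. *)
Lemma opt_le (V : finType) (p q : arrangement V) (h : seq (graph V)) :
  all (@minla V ^~ q) h -> opt (Instance p h) <= kendall_tau p q.
Proof.
move=> min_q; pose sol := nseq (size h) q.
have cost_sol : cost (Instance p h) sol <= kendall_tau p q.
  rewrite /cost /sol /=; case: (size h) => //= n.
  rewrite -[leqRHS]addn0 leq_add2l.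
  by elim: n => //= n IHn; rewrite kendall_tau_self.
apply: leq_trans cost_sol; rewrite /opt; case: ex_minnP => m _; apply.
apply/existsP; exists (nseq_tuple (size h) q); rewrite eqxx andbT /feasible /=.
by elim: h min_q {sol} => //= G h IHh /andP[->].
Qed.

Lemma opt_le_cost (V : finType) (sigma : instance V) (sol : seq (arrangement V)) :
  feasible sigma sol -> opt sigma <= cost sigma sol.
Proof.
move=> feas; rewrite /opt; case: ex_minnP => m _; apply.
have /eqP size_sol : size sol == size (revealed sigma).
  by move: feas; rewrite /feasible all2E eq_sym => /andP[].
have /eqP size_t := size_sol.
by apply/existsP; exists (Tuple size_t); rewrite feas eqxx.
Qed.

(** * Extending an instance by one graph *)

Lemma cost_rcons (V : finType) (p0 : arrangement V) h h' sol p :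
  cost (Instance p0 h) (rcons sol p) =
  cost (Instance p0 h') sol + kendall_tau (last p0 sol) p.
Proof.
rewrite /cost /=; elim: sol p0 => //= [|q sol IHsol] p0; first by rewrite addn0.
by rewrite IHsol addnA.
Qed.

(** This is where the algorithm is online: a further graph does not affect earlier choices. The
    adversary can thus choose the next graph from the law of the current arrangement. *)
Lemma run_rcons (V : finType) (A : online_algorithm V) p0 h G :
  run A (Instance p0 (rcons h G)) =
  rcons (run A (Instance p0 h)) (A p0 (rcons h G)).
Proof.
rewrite /run /= size_rcons mkseqS take_oversize ?size_rcons //; congr rcons.
apply/eq_in_map => i; rewrite mem_iota add0n => lt_i.
by rewrite -cats1 takel_cat.
Qed.

Lemma feasible_rcons (V : finType) (p0 : arrangement V) h G sol p :
  size sol = size h ->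
  feasible (Instance p0 (rcons h G)) (rcons sol p) =
  feasible (Instance p0 h) sol && minla G p.
Proof.
move=> sz; rewrite /feasible /= !all2E !size_rcons sz !eqxx /=.
by rewrite zip_rcons // all_rcons andbC.
Qed.

Lemma instance_of_nil (cls : instance_class) (V : finType) (p0 : arrangement V) :
  instance_of cls (Instance p0 [::]).
Proof.
split=> // -[|//] _; rewrite /graph_at /=.
have := @class_graph_blocks cls V [::] isT.
by rewrite /block_graph big_nil.
Qed.

Lemma instance_of_rcons (cls : instance_class) (V : finType)
    (p0 : arrangement V) h G :
  instance_of cls (Instance p0 h) -> class_graph cls G ->
  class_step cls (last finset.set0 h) G ->
  instance_of cls (Instance p0 (rcons h G)).
Proof.
have nthE i : graph_at (Instance p0 (rcons h G)) i =
    if i <= size h then graph_at (Instance p0 h) i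
    else if i == (size h).+1 then G else finset.set0.
  by rewrite /graph_at /= -rcons_cons nth_rcons.
move=> [cls_h step_h] cls_G step_G; split=> i /=; rewrite size_rcons.
  rewrite nthE; case: ifP => [le_i _|]; first exact: cls_h.
  by move=> lt_i le_i; rewrite (_ : i == _) //; lia.
rewrite ltnS => le_i; rewrite !nthE le_i; case: ifP => [lt_i|]; first exact: step_h.
move=> ge_i; have -> : i = size h by lia.
by rewrite eqxx /graph_at /= -last_nth.
Qed.

From mathcomp Require Import all_order all_algebra.
From mathcomp Require Import all_classical all_reals all_analysis.
From mathcomp Require Import measurable_realfun.
From mathcomp Require Import ring lra.
Import Order.TTheory GRing.Theory Num.Theory.
Local Open Scope ring_scope.

(** * Expectations of functions of a finite random variable *)

Section FiniteExpectation.
Variables (R : realType) (d : measure_display) (T : measurableType d).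
Variables (P : probability T R) (F : finType) (X : T -> F).
Hypothesis mX : forall p, measurable [set w | X w = p]%classic.

Lemma measurable_finite (h : F -> R) : measurable_fun setT (fun w => h (X w)).
Proof.
move=> _ Y mY; rewrite setTI.
rewrite [X in measurable X](_ : _ = (\bigcup_(p in [set p | Y (h p)]) [set w | X w = p])%classic).
  by apply: fin_bigcup_measurable => //; exact: finite_finset.
by apply/seteqP; split=> [w Yw|w [p Yp /= Xw]]; [exists (X w)|rewrite /= Xw].
Qed.

Definition law p : R := fine (P [set w | X w = p]%classic).

Lemma expectation_finite (h : F -> R) : (forall p, 0 <= h p) ->
  ('E_P[fun w => h (X w)] = (\sum_p law p * h p)%:E)%E.
Proof.
move=> h0; rewrite unlock.
(* Decompose along the fibres of [X]: at [w] only the term of [X w] survives. *)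
have -> : (fun w => (h (X w))%:E) = 
   (fun w => \sum_p (h p * \1_[set w | X w = p]%classic w)%:E)%E.
  apply/funext => w; rewrite sumEFin (bigD1 (X w)) //= big1 ?addr0.
    by rewrite indicE mem_set // mulr1.
  move=> p pX; rewrite indicE memNset ?mulr0 //= => eqp.
  by rewrite eqp eqxx in pX.
rewrite ge0_integral_sum //; last 2 first.
- move=> p; apply/measurable_EFinP; apply: measurable_funM => /=.
  exact: measurable_cst.
  exact: measurable_indic.
- by move=> p w _; rewrite lee_fin mulr_ge0.
rewrite -sumEFin; apply: eq_bigr => p _.
under eq_integral do rewrite EFinM.
rewrite ge0_integralZl_EFin //=; last first.
  by apply/measurable_EFinP; exact: measurable_indic.
rewrite integral_indic // setIT EFinM muleC /law fineK //.
exact: fin_num_measure.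
Qed.

Lemma law_ge0 p : 0 <= law p.
Proof. exact: fine_ge0. Qed.

Lemma law_eq0 p : (forall w, X w != p) -> law p = 0.
Proof.
move=> Xp; rewrite /law [X in P X](_ : _ = set0) ?measure0 //.
by apply/seteqP; split=> // w /= /eqP; rewrite (negPf (Xp w)).
Qed.

Lemma sum_law : \sum_p law p = 1.
Proof.
have := @expectation_finite (fun=> 1) (fun=> ler01).
rewrite (expectation_cst P 1) => -[->].
by apply: eq_bigr => p _; rewrite mulr1.
Qed.
End FiniteExpectation.

(** * The averaging argument *)

Lemma remove_two (U : eqType) (rs : seq U) (u v : U) :
  uniq rs -> u \in rs -> v \in rs -> u != v ->
  exists2 rs', perm_eq rs [:: u, v & rs'] &
    forall (R : nmodType) (F : U -> R),
      \sum_(l <- rs | (l != u) && (l != v)) F l = \sum_(l <- rs') F l.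
Proof.
move=> uniq_rs rs_u rs_v uv; exists (rem v (rem u rs)).
  apply: perm_trans (perm_to_rem rs_u) _; rewrite perm_cons.
  by apply: perm_to_rem; rewrite mem_rem_uniq // inE rs_v eq_sym uv.
move=> R F; rewrite -big_filter; congr (\big[_/_]_(l <- _) _).
rewrite !rem_filter ?filter_uniq // -filter_predI.
by apply: eq_filter => l; rewrite /= andbC.
Qed.

(* Summed over all triples of distinct elements, [f] is invariant under cyclic
   rotation of its arguments; so 3 * sum f is at least the number of triples. *)
Lemma exists_good_pair (R : realFieldType) (U : eqType) (rs : seq U)
    (f : U -> U -> U -> R) :
  uniq rs -> (1 < size rs)%N ->
  {in rs & rs & rs, forall u l v, u != l -> l != v -> v != u ->
     1 <= f u l v + f l v u + f v u l} ->
  exists u v, [/\ u \in rs, v \in rs, u != v &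
    (size rs - 2)%:R / 3 <= \sum_(l <- rs | (l != u) && (l != v)) f u l v].
Proof.
(* Suppose every pair falls below the claimed average; summing over all pairs will contradict the
   count of triples. *)
move=> uniq_rs gt1 f_cycle; apply: contrapT => no_pair.
set c := (size rs - 2)%:R : R.
pose g u v := \sum_(l <- rs | (l != u) && (l != v)) f u l v.
have lt_g u v : u \in rs -> v \in rs -> u != v -> 3 * g u v < c.
  move=> rs_u rs_v uv; rewrite ltNge; apply/negP => le_c; apply: no_pair.
  by exists u, v; split=> //; rewrite ler_pdivrMr // mulrC.
have lt_sum : \sum_(u <- rs) \sum_(v <- rs | v != u) 3 * g u v <
              \sum_(u <- rs) \sum_(v <- rs | v != u) c.
  rewrite big_seq [ltRHS]big_seq; apply: ltr_sum.
    by case: (rs) gt1 => //= u rs' _; rewrite mem_head.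
  move=> u rs_u; rewrite big_seq_cond [ltRHS]big_seq_cond; apply: ltr_sum.
    (* Strictness needs a nonempty inner sum: one of the first two elements differs from [u]. *)
    case: (rs) uniq_rs gt1 rs_u => [|a [|b rs']] //=; rewrite !inE negb_or.
    case/andP=> /andP[ab _] _ _ _; rewrite !eqxx !orbT /=.
    by case: (eqVneq a u) => //= eq_au; rewrite -eq_au eq_sym ab.
  by move=> v /andP[rs_v vu]; apply: lt_g; rewrite // eq_sym.
move: lt_sum; apply/negP; rewrite -leNgt.
pose D (u l v : U) := [&& u != l, l != v & v != u].
(* Extending [f] by zero to triples with repetitions frees the sums from side conditions, so that
   they can be exchanged. *)
pose F u l v := if D u l v then f u l v else 0.
have sumE (h : U -> U -> U -> R) :
    \sum_(u <- rs) \sum_(v <- rs | v != u) \sum_(l <- rs | (l != u) && (l != v)) h u l v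
    = \sum_(u <- rs) \sum_(v <- rs) \sum_(l <- rs) if D u l v then h u l v else 0.
  apply: eq_bigr => u _; rewrite big_mkcond; apply: eq_bigr => v _.
  rewrite big_mkcond /D; case: (v =P u) => _ /=.
    by rewrite big1 // => l _; rewrite !andbF.
  by apply: eq_bigr => l _; rewrite andbT eq_sym.
have rot (h : U -> U -> U -> R) :
    \sum_(u <- rs) \sum_(v <- rs) \sum_(l <- rs) h u l v =
    \sum_(u <- rs) \sum_(v <- rs) \sum_(l <- rs) h l v u.
  by rewrite exchange_big; apply: eq_bigr => v _; rewrite exchange_big.
(* For distinct [u] and [v] there are exactly [c] choices of [l], so the left side counts the
   triples of distinct elements. *)
have -> : \sum_(u <- rs) \sum_(v <- rs | v != u) c =
    \sum_(u <- rs) \sum_(v <- rs) \sum_(l <- rs) (D u l v)%:R.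
  rewrite [RHS](_ : _ = \sum_(u <- rs) \sum_(v <- rs) \sum_(l <- rs)
    if D u l v then 1 else 0); last first.
    by do 3!apply: eq_bigr => ? _; case: (D _ _ _).
  rewrite -(sumE (fun _ _ _ => 1)) big_seq [RHS]big_seq; apply: eq_bigr => u rs_u.
  rewrite big_seq_cond [RHS]big_seq_cond; apply: eq_bigr => v /andP[rs_v vu].
  have uv : u != v by rewrite eq_sym.
  have [rs' /perm_size/= size_rs ->] := remove_two uniq_rs rs_u rs_v uv.
  by rewrite big_const_seq count_predT iter_addr_0 /c size_rs subn2.
have -> : \sum_(u <- rs) \sum_(v <- rs | v != u) 3 * g u v =
    \sum_(u <- rs) \sum_(v <- rs) \sum_(l <- rs) (F u l v + F l v u + F v u l).
  have r1 := rot F; have r2 := rot (fun u l v => F l v u).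
  rewrite /= in r1 r2.
  pose S := \sum_(u <- rs) \sum_(v <- rs) \sum_(l <- rs) F u l v.
  transitivity (S + S + S).
    have -> : S + S + S = 3 * S by ring.
    rewrite /S /F -sumE mulr_sumr; apply: eq_bigr => u _.
    by rewrite mulr_sumr.
  have e2 : S = \sum_(u <- rs) \sum_(v <- rs) \sum_(l <- rs) F l v u by [].
  have e3 : S = \sum_(u <- rs) \sum_(v <- rs) \sum_(l <- rs) F v u l.
    by rewrite -r2.
  rewrite {2}e2 {2}e3 /S -!big_split /=; apply: eq_bigr => u _.
  by rewrite -!big_split /=; apply: eq_bigr => v _; rewrite -!big_split.
rewrite big_seq [leRHS]big_seq; apply: ler_sum => u rs_u.
rewrite big_seq [leRHS]big_seq; apply: ler_sum => v rs_v.
rewrite big_seq [leRHS]big_seq; apply: ler_sum => l rs_l.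
rewrite /F /D; case: (boolP (u != l)) => [ul|Nul]; case: (boolP (l != v)) => [lv|Nlv];
  case: (boolP (v != u)) => [vu|Nvu] //=; rewrite ?addr0 //.
exact: f_cycle.
Qed.

(** * The adversary *)

Lemma instance_of_prefix (cls : instance_class) (V : finType)
    (p0 : arrangement V) h G :
  instance_of cls (Instance p0 (rcons h G)) -> instance_of cls (Instance p0 h).
Proof.
have nthE i : (i <= size h)%N ->
    graph_at (Instance p0 (rcons h G)) i = graph_at (Instance p0 h) i.
  by move=> le_i; rewrite /graph_at /= -rcons_cons nth_rcons /= ltnS le_i.
move=> [/=]; rewrite size_rcons => cls_h step_h; split=> i /= le_i.
  by rewrite -nthE //; apply: cls_h; rewrite ltnW.
by rewrite -nthE 1?ltnW // -nthE //; apply: step_h; rewrite ltnW.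
Qed.

Section Adversary.
Variables (R : realType) (cls : instance_class) (V : finType).
Variables (d : measure_display) (T : measurableType d) (P : probability T R).
Variables (A : T -> online_algorithm V) (p0 : arrangement V).
Variable U : seq V.
Hypothesis A_alg : randomized_online_algorithm cls A.
Implicit Types (h : seq (graph V)) (bs rs : seq (seq V)).

(** For the empty history this is the initial arrangement [p0]. *)
Definition current h w : arrangement V := last p0 (run (A w) (Instance p0 h)).

Definition run_cost h w : R := (cost (Instance p0 h) (run (A w) (Instance p0 h)))%:R.

Lemma current_rcons h G w : current (rcons h G) w = A w p0 (rcons h G).
Proof. by rewrite /current run_rcons last_rcons. Qed.

Lemma run_cost_rcons h G w : run_cost (rcons h G) w =
  run_cost h w + (kendall_tau (current h w) (current (rcons h G) w))%:R.
Proof.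
by rewrite /run_cost run_rcons (cost_rcons p0 _ h) natrD current_rcons.
Qed.

Lemma measurable_current h p : instance_of cls (Instance p0 h) ->
  measurable [set w | current h w = p]%classic.
Proof.
case/lastP: h => [|h G] inst; last first.
  under eq_set do rewrite current_rcons.
  by have [+ _] := A_alg inst; apply.
have [eqp|p0p] := eqVneq p0 p.
  by rewrite [X in measurable X](_ : _ = setT) //; apply/seteqP; split.
rewrite [X in measurable X](_ : _ = set0) //; apply/seteqP; split=> // w /= eq_p.
by rewrite -eq_p eqxx in p0p.
Qed.

Lemma measurable_step h G : instance_of cls (Instance p0 (rcons h G)) ->
  measurable_fun setT
    (fun w => (kendall_tau (current h w) (current (rcons h G) w))%:R : R).
Proof.
move=> inst.
pose X w := (current h w, current (rcons h G) w).
apply: (@measurable_finite R d T (arrangement V * arrangement V)%type X _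
  (fun pq => (kendall_tau pq.1 pq.2)%:R)) => -[p q].
rewrite [Y in measurable Y](_ : _ = ([set w | current h w = p] `&`
  [set w | current (rcons h G) w = q])%classic).
  apply: measurableI; apply: measurable_current => //.
  exact: instance_of_prefix inst.
by apply/seteqP; split=> w; [case|rewrite /= /X => -[-> ->]].
Qed.

Lemma measurable_run_cost h : instance_of cls (Instance p0 h) ->
  measurable_fun setT (run_cost h).
Proof.
elim/last_ind: h => [|h G IHh] inst; first exact: measurable_cst.
rewrite (funext (run_cost_rcons h G)).
apply: measurable_funD; last exact: measurable_step.
exact/IHh/(instance_of_prefix inst).
Qed.

Lemma expectation_run_cost_rcons h G :
  instance_of cls (Instance p0 (rcons h G)) ->
  ('E_P[run_cost (rcons h G)] = 'E_P[run_cost h] +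
    'E_P[fun w => (kendall_tau (current h w) (current (rcons h G) w))%:R])%E.
Proof.
move=> inst; rewrite unlock -ge0_integralD //=.
- by apply: eq_integral => w _; rewrite run_cost_rcons EFinD.
- by move=> w _; rewrite lee_fin ler0n.
- by apply/measurable_EFinP/measurable_run_cost/(instance_of_prefix inst).
- exact/measurable_EFinP/measurable_step.
Qed.

(* [U] lists the nodes that the adversary merges; all other nodes stay isolated
   and are not listed in [bs]. *)
Record adversary_state h bs (B : R) : Prop := AdversaryState {
  state_instance : instance_of cls (Instance p0 h);
  state_uniq : uniq (flatten bs);
  state_support : perm_eq (flatten bs) U;
  state_nonempty : [::] \notin bs;
  state_last : last finset.set0 h = block_graph cls bs;
  state_contiguous : forall w s, s \in bs -> contiguous (current h w) s;
  state_minla : forall q, (forall s, s \in bs -> laid_out q s) ->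
    all (@minla V ^~ q) h;
  state_cost : (B%:E <= 'E_P[run_cost h])%E
}.

Lemma adversary_state_perm h bs bs' B : perm_eq bs bs' ->
  adversary_state h bs B -> adversary_state h bs' B.
Proof.
move=> eq_bs [inst uniq_bs supp ne_bs last_h contig min_h cost_h]; split=> //.
- by rewrite -(perm_uniq (perm_flatten eq_bs)).
- by rewrite -(permPl (perm_flatten eq_bs)).
- by rewrite -(perm_mem eq_bs).
- by rewrite -(block_graph_perm _ eq_bs).
- by move=> w s bs_s; apply: contig; rewrite (perm_mem eq_bs).
- by move=> q lay; apply: min_h => s bs_s; apply: lay; rewrite -(perm_mem eq_bs).
Qed.

(** The probability that [s2] lies between [s1] and [s3] in the current arrangement. *)
Definition expected_between h (s1 s2 s3 : seq V) : R :=
  \sum_p law P (current h) p * (block_between p s1 s2 s3)%:R.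

Lemma expected_between_cycle h bs B (s1 s2 s3 : seq V) :
  adversary_state h bs B -> {subset [:: s1; s2; s3] <= bs} ->
  s1 != s2 -> s2 != s3 -> s3 != s1 ->
  1 <= expected_between h s1 s2 s3 + expected_between h s2 s3 s1 +
       expected_between h s3 s1 s2.
Proof.
move=> st sub12 n12 n23 n31.
have mcur p := measurable_current p (state_instance st).
rewrite -(sum_law P mcur) -!big_split /=; apply: ler_sum => p _.
rewrite -!mulrDr -[leLHS]mulr1.
(* Contiguity is known only for arrangements that the algorithm can reach; all others have
   probability zero. *)
have [[w <-]|/forallNP Np] := pselect (exists w, current h w = p); last first.
  by rewrite law_eq0 ?mul0r // => w; apply/eqP/Np.
apply: ler_wpM2l; first exact: law_ge0.
have contig s : s \in bs -> contiguous (current h w) s.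
  exact: (state_contiguous st).
have dis s t : s \in bs -> t \in bs -> s != t -> {in s, forall x, x \notin t}.
  move=> bs_s bs_t st' x sx; apply: contra st' => tx; apply/eqP.
  exact: uniq_flatten_eq (state_uniq st) bs_s bs_t sx tx.
have [b1 b2 b3] : [/\ s1 \in bs, s2 \in bs & s3 \in bs].
  by split; apply: sub12; rewrite !inE eqxx ?orbT.
have := block_between_cycle (contig _ b1) (contig _ b2) (contig _ b3)
  (dis _ _ b1 b2 n12) (dis _ _ b2 b3 n23) (dis _ _ b3 b1 n31).
case: block_between; case: block_between; case: block_between => //= _;
  rewrite -!natrD ler1n //.
Qed.

(** Revealing the merged block forces it to be contiguous, so [block_between_cost] bounds the move
    for each outcome of the random bits. Only the blocks of [ls] are charged; [rest] may contain
    blocks of other sizes. *)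
Lemma adversary_merge h s1 s2 ls rest (L : nat) B :
  adversary_state h [:: s1, s2 & ls ++ rest] B ->
  size s1 = L -> size s2 = L -> {in ls, forall s, size s = L} ->
  exists h', adversary_state h' ((s1 ++ s2) :: ls ++ rest)
    (B + (L * L)%:R * \sum_(s <- ls) expected_between h s1 s s2).
Proof.
move=> st sz1 sz2 sz; set bs' := _ :: ls ++ rest.
have [inst uniq_bs supp ne_bs last_h contig min_h cost_h] := st.
have uniq_bs' : uniq (flatten bs') by move: uniq_bs; rewrite /= catA.
move: (ne_bs); rewrite !inE !negb_or !(eq_sym [::]) => /and3P[ne1 ne2 ne_ls].
set G := block_graph cls bs'; exists (rcons h G).
have inst' : instance_of cls (Instance p0 (rcons h G)).
  apply: instance_of_rcons => //; first exact: class_graph_blocks.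
  by rewrite last_h; apply: class_step_merge.
have contig' w s : s \in bs' -> contiguous (current (rcons h G) w) s.
  apply: (@minla_contiguous cls) => //; have [_ /(_ w)] := A_alg inst'.
  by rewrite run_rcons feasible_rcons ?size_mkseq // current_rcons => /andP[].
split=> //.
- by move: supp; rewrite /= catA.
- rewrite inE negb_or ne_ls andbT eq_sym.
  by case: (s1) ne1.
- by rewrite last_rcons.
(* An arrangement listing [s1 ++ s2] in order also lays out both halves, so it stays optimal for all
   earlier graphs. *)
- move=> q lay; rewrite all_rcons (minla_laid_out _ uniq_bs') //=; apply: min_h => s.
  have lay12 : laid_out q (s1 ++ s2) by apply: lay; rewrite mem_head.
  rewrite !inE => /predU1P[->|/predU1P[->|bs_s]].
  + exact: laid_out_catl lay12.
  + exact: laid_out_catr lay12.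
  + by apply: lay; rewrite inE bs_s orbT.
rewrite expectation_run_cost_rcons // EFinD leeD //.
pose g p : R := (L * L * \sum_(s <- ls) block_between p s1 s s2)%N%:R.
have mcur p := measurable_current p inst.
apply: (@le_trans _ _ ('E_P[fun w => g (current h w)])%E).
  rewrite (expectation_finite _ mcur) ?lee_fin; last by move=> p; rewrite ler0n.
  rewrite /expected_between exchange_big mulr_sumr le_eqVlt; apply/orP; left.
  apply/eqP/eq_bigr => p _.
  by rewrite /g (natrM _ (L * L)%N) natr_sum -mulr_sumr mulrCA.
apply: expectation_le => //.
- exact: measurable_finite.
- exact: measurable_step.
apply: aeW => w; rewrite ler_nat; apply: block_between_cost => //.
- by move: uniq_bs; rewrite /= flatten_cat !catA cat_uniq => /and3P[].
- by apply: contig'; rewrite mem_head.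
Qed.

Lemma adversary_state_le h bs B B' : B' <= B ->
  adversary_state h bs B -> adversary_state h bs B'.
Proof.
move=> leB [inst uniq_bs supp ne_bs last_h contig min_h cost_h]; split=> //.
by apply: le_trans cost_h; rewrite lee_fin.
Qed.

Lemma uniq_flatten_uniq (S : eqType) (ss : seq (seq S)) :
  uniq (flatten ss) -> [::] \notin ss -> uniq ss.
Proof.
elim: ss => //= s ss IHss; rewrite cat_uniq inE negb_or => /and3P[_ /hasPn dis uniq_ss].
case/andP=> ne_s ne_ss; rewrite IHss // andbT; apply/negP => ss_s.
case: s ne_s dis ss_s => // x s _ dis ss_s.
have fx : x \in flatten ss by apply/flattenP; exists (x :: s); rewrite ?mem_head.
by have := dis x fx; rewrite /= mem_head.
Qed.

(** The averaging argument applied to the probabilities [expected_between] selects the pair to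
    merge. Here [rs] holds the blocks still unmerged in the round. *)
Lemma adversary_step h rs rest (L : nat) B :
  adversary_state h (rs ++ rest) B -> {in rs, forall s, size s = L} ->
  (1 < size rs)%N ->
  exists h' u v rs', perm_eq rs [:: u, v & rs'] /\
    adversary_state h' ((u ++ v) :: rs' ++ rest)
      (B + (L * L)%:R * ((size rs - 2)%:R / 3)).
Proof.
move=> st sz gt1.
have sub_rs s : s \in rs -> s \in rs ++ rest by rewrite mem_cat => ->.
have uniq_rs : uniq rs.
  have := uniq_flatten_uniq (state_uniq st) (state_nonempty st).
  by rewrite cat_uniq => /andP[].
have [|u [v [rs_u rs_v uv le_sum]]] := @exists_good_pair R _ rs (expected_between h) uniq_rs gt1.
  move=> u l v rs_u rs_l rs_v ul lv vu; apply: (expected_between_cycle st) => //.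
  by move=> s; rewrite !inE => /or3P[]/eqP->; apply: sub_rs.
have [rs' eq_rs sumE] := remove_two uniq_rs rs_u rs_v uv.
have sz' : {in rs', forall s, size s = L}.
  by move=> s rs_s; apply: sz; rewrite (perm_mem eq_rs) !inE rs_s !orbT.
have st' : adversary_state h [:: u, v & rs' ++ rest] B.
  by apply: adversary_state_perm st; rewrite -!cat_cons perm_cat2r.
have [h' st''] := adversary_merge st' (sz u rs_u) (sz v rs_v) sz'.
exists h', u, v, rs'; split=> //; apply: adversary_state_le st''.
by rewrite lerD2l ler_wpM2l // -sumE.
Qed.

(** One round. With [2 * j] unmerged blocks left a merge gains [L ^ 2 * (2 * j - 2) / 3], and the
    numbers [2 * j - 2] for [j] from 1 to [i] add up to [i ^ 2 - i]. *)
Lemma adversary_level (i : nat) h rs rest (L : nat) B :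
  size rs = i.*2 -> {in rs, forall s, size s = L} ->
  adversary_state h (rs ++ rest) B ->
  exists h' rs', [/\ size rs' = i, {in rs', forall s, size s = L.*2} &
    adversary_state h' (rs' ++ rest) (B + L%:R ^+ 2 * (i%:R ^+ 2 - i%:R) / 3)].
Proof.
elim: i h rs rest B => [|i IHi] h rs rest B size_rs sz st.
  exists h, [::]; split=> //; case: rs size_rs {sz} st => // _.
  by apply: adversary_state_le; rewrite expr0n /= subrr mulr0 mul0r addr0.
have [|h1 [u [v [rs1 [eq_rs st1]]]]] := adversary_step st sz; first by rewrite size_rs.
have sz1 : {in rs1, forall s, size s = L}.
  by move=> s rs_s; apply: sz; rewrite (perm_mem eq_rs) !inE rs_s !orbT.
have size1 : size rs1 = i.*2.
  by have := perm_size eq_rs; rewrite size_rs doubleS => -[<-].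
(* The new block moves to [rest] until the next round. *)
have {}st1 : adversary_state h1 (rs1 ++ (u ++ v) :: rest)
    (B + (L * L)%:R * ((size rs - 2)%:R / 3)).
  by apply: adversary_state_perm st1; rewrite -cat_cons -cat_rcons perm_cat2r perm_sym perm_rcons.
have [h2 [rs2 [size2 sz2 st2]]] := IHi _ _ _ _ size1 sz1 st1.
exists h2, (rcons rs2 (u ++ v)); split.
- by rewrite size_rcons size2.
- move=> s; rewrite mem_rcons inE => /predU1P[->|/sz2//].
  by rewrite size_cat !sz ?addnn // (perm_mem eq_rs) !inE eqxx ?orbT.
rewrite cat_rcons; apply: adversary_state_le st2.
rewrite size_rs doubleS subn2 /= natrM -muln2 natrM -[i.+1]addn1 natrD.
by rewrite le_eqVlt; apply/orP; left; apply/eqP; field.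
Qed.

(** Let [N = L * 2 ^ k]. A round starting with blocks of size [M] gains [N ^ 2 / 12 - N * M / 6],
    and the sizes [M = L, 2 * L, ..., N / 2] add up to [N - L]. *)
Lemma adversary_levels (k : nat) h bs (L : nat) B :
  size bs = (2 ^ k)%N -> {in bs, forall s, size s = L} ->
  adversary_state h bs B ->
  exists h' s, [/\ size s = (L * 2 ^ k)%N & adversary_state h' [:: s]
    (B + (L * 2 ^ k)%:R ^+ 2 * k%:R / 12
       - (L * 2 ^ k)%:R * ((L * 2 ^ k)%:R - L%:R) / 6)].
Proof.
elim: k h bs L B => [|k IHk] h bs L B size_bs sz st.
  case: bs size_bs sz st => [|s []] // _ sz st; exists h, s.
  split; first by rewrite muln1 sz ?mem_head.
  by apply: adversary_state_le st; rewrite muln1 subrr !mulr0 !mul0r subr0 addr0.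
rewrite -[bs]cats0 in st.
have [|h1 [rs1 [size1 sz1]]] := adversary_level _ sz st (i := (2 ^ k)%N).
  by rewrite size_bs expnS mul2n.
rewrite cats0 => st1.
have [h2 [s [size_s st2]]] := IHk _ _ _ _ size1 sz1 st1.
exists h2, s; split; first by rewrite size_s -muln2 expnS mulnA.
apply: adversary_state_le st2; rewrite le_eqVlt; apply/orP; left; apply/eqP.
rewrite expnS -muln2 !natrM -[k.+1]addn1 natrD.
by field.
Qed.

Lemma adversary_start : uniq U -> adversary_state [::] [seq [:: x] | x <- U] 0.
Proof.
move=> uniq_U; have flatU : flatten [seq [:: x] | x <- U] = U.
  by rewrite (flatten_map1 id) map_id.
split; rewrite ?flatU //.
- exact: instance_of_nil.
- by apply/negP => /mapP[].
- rewrite /block_graph big1_seq //= => s /mapP[x _ ->].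
  by rewrite block_edges_short.
- move=> w _ /mapP[x _ ->] a b c; rewrite !inE => /eqP-> /eqP->; lia.
- by apply: expectation_ge0 => w; rewrite ler0n.
Qed.

End Adversary.

(** * The lower bound *)

Section LowerBound.
Variables (R : realType) (cls : instance_class) (V : finType).
Variables (d : measure_display) (T : measurableType d) (P : probability T R).
Variables (A : T -> online_algorithm V) (c : R).
Hypothesis A_alg : randomized_online_algorithm cls A.
Hypothesis A_comp : competitive cls P A c.

(** Joining the nodes at positions 0 and 2 expels the node at position 1 from between them, which
    costs at least one inversion. *)
Lemma exists_positive_opt : (2 < #|V|)%N ->
  exists2 sigma : instance V, instance_of cls sigma & (0 < opt sigma)%N.
Proof.
move=> gt2; have [p0 _] := @exists_laid_out V [::] isT.
have [x px] := @pos_surj _ p0 0 (ltnW (ltnW gt2)).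
have [y py] := @pos_surj _ p0 1 (ltnW gt2).
have [z pz] := @pos_surj _ p0 2 gt2.
have xz : x != z by rewrite -(pos_eq p0) px pz.
pose G := block_graph cls [:: [:: x; z]].
have uniq_xz : uniq (flatten [:: [:: x; z]]) by rewrite /= inE xz.
exists (Instance p0 [:: G]).
  rewrite -[[:: G]]/(rcons [::] G); apply: instance_of_rcons.
  - exact: instance_of_nil.
  - exact: class_graph_blocks.
  - have := @class_step_merge cls V [:: x] [:: z] [::] uniq_xz isT isT.
    rewrite {1}/block_graph big1_seq //= => s; rewrite !inE.
    by case/predU1P=> [->|/eqP->]; rewrite block_edges_short.
rewrite /opt; case: ex_minnP => m /existsP[[[|q [|//]] //= sz]] /andP[feas].
move=> /eqP <- _; rewrite /cost /= addn0.
have min_q : minla G q by move: feas; rewrite /feasible /= andbT.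
have contig := minla_contiguous uniq_xz min_q (mem_head _ _).
apply: leq_trans (inversions_le_kendall_tau p0 q); rewrite card_gt0.
have btw : between p0 x y z by rewrite /between px py pz.
have Nbtw : ~~ between q x y z.
  have Ny : y \notin [:: x; z] by rewrite !inE -!(pos_eq p0) px py pz.
  apply: contra Ny => /orP[] lt; apply: contig lt; rewrite !inE eqxx ?orbT //.
apply/finset.set0Pn.
by case/orP: (inverted_between btw Nbtw) => /orP[] inv; eexists; apply: inv.
Qed.

(** Every run is a feasible solution, so the expected cost is at least the optimum, which cancels
    when it is positive. *)
Lemma competitive_ge1 : (2 < #|V|)%N -> 1 <= c.
Proof.
move=> /exists_positive_opt[[p0 h] inst opt_gt0].
have := A_comp inst; have opt_gt0R : 0 < (opt (Instance p0 h))%:R :> R by rewrite ltr0n.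
have le_opt : ((opt (Instance p0 h))%:R%:E <= 'E_P[run_cost R A p0 h])%E.
  rewrite -(expectation_cst P); apply: expectation_le => //.
    exact: (measurable_run_cost A_alg).
  apply: aeW => w; rewrite ler_nat; apply: opt_le_cost.
  by have [_] := A_alg inst.
move/(le_trans le_opt); rewrite lee_fin.
by rewrite -{1}[X in X <= _]mul1r ler_pM2r.
Qed.

Lemma competitive_ge_log (k : nat) : (2 ^ k <= #|V|)%N -> 0 <= c ->
  (k%:R - 2) / 12 <= c.
Proof.
move=> le_kn c_ge0; have [p0 _] := @exists_laid_out V [::] isT.
(* The adversary uses the first [2 ^ k] nodes of [p0], so that [rearranged_prefix] bounds the
   optimum by [(2 ^ k) ^ 2]. *)
pose U := [seq x <- enum V | (pos p0 x < 2 ^ k)%N].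
have uniq_U : uniq U by rewrite filter_uniq ?enum_uniq.
have size_U : size U = (2 ^ k)%N.
  rewrite -(card_uniqP uniq_U) -[RHS](card_before p0 le_kn).
  by apply: eq_card => x; rewrite mem_filter mem_enum !inE andbT.
have st0 := @adversary_start R cls V d T P A p0 U uniq_U.
have [||h [s [size_s st]]] := adversary_levels (k := k) (L := 1) A_alg _ _ st0.
- by rewrite size_map.
- by move=> _ /mapP[x _ ->].
have eq_sU : perm_eq s U by have := state_support st; rewrite /= cats0.
have [||q lay_q le_q] := @rearranged_prefix V p0 s.
- by rewrite (perm_uniq eq_sU).
- by move=> x; rewrite (perm_mem eq_sU) mem_filter mem_enum andbT size_s mul1n.
have opt_h : (opt (Instance p0 h) <= 2 ^ k * 2 ^ k)%N.
  rewrite -[(2 ^ k)%N]mul1n -size_s; apply: leq_trans le_q; apply: opt_le.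
  by apply: (state_minla st) => _ /predU1P[->|//].
have := le_trans (state_cost st) (A_comp (state_instance st)).
rewrite lee_fin mul1n add0r => le_B.
have : (opt (Instance p0 h))%:R <= (2 ^ k)%:R ^+ 2 :> R.
  by rewrite expr2 -natrM ler_nat.
move/(ler_wpM2l c_ge0)/(le_trans le_B).
have : 1 <= (2 ^ k)%:R :> R by rewrite ler1n expn_gt0.
move: (2 ^ k)%:R => N N1 le_cN.
(* It remains to divide by [N ^ 2]; the correction [N * (N - 1) / 6] is at most [N ^ 2 / 6], whence
   the [- 2] in the bound. *)
have N2 : 0 < N ^+ 2 by nra.
rewrite -(ler_pM2r N2); nra.
Qed.

End LowerBound.

Theorem theorem15 (R : realType) (cls : instance_class) (V : finType) (n : nat)
    (card_V : #|V| = n) (n_gt2 : (2 < n)%N)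
    (d : measure_display) (T : measurableType d) (P : probability T R)
    (A : T -> online_algorithm V) (c : R)
    (A_alg : randomized_online_algorithm cls A)
    (A_comp : competitive cls P A c) :
  16%:R^-1 * (ln n%:R / ln 2%:R) <= c.
Proof.
have c_ge1 : 1 <= c by apply: (competitive_ge1 A_alg A_comp); rewrite card_V.
pose k := trunc_log 2 n.
have n_gt0 : (0 < n)%N by apply: leq_trans n_gt2.
have /andP[le_kn lt_nk] := trunc_log_bounds (isT : (1 < 2)%N) n_gt0.
have c_gelog : (k%:R - 2) / 12 <= c.
  by apply: (competitive_ge_log A_alg A_comp); rewrite ?card_V //; lra.
have ln2_gt0 : 0 < ln 2 :> R by rewrite ln_gt0 ?ltr1n.
have log_le : ln n%:R / ln 2%:R <= k%:R + 1 :> R.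
  rewrite ler_pdivrMr // natr1 mulr_natl -lnXn ?ltr0n // -natrX.
  by rewrite ler_ln ?posrE ?ltr0n ?expn_gt0 // ler_nat ltnW.
(* For [k <= 15] the logarithm is at most 16 and [1 <= c] suffices. For larger [k],
   [(k + 1) / 16 <= (k - 2) / 12], which holds from [k = 11] on. *)
have [le_k|lt_k] := leqP k 15.
  have : k%:R <= 15 :> R by rewrite ler_nat.
  lra.
have : 16 <= k%:R :> R by rewrite ler_nat.
lra.
Qed.
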